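(* Let $M$ be a term of the CCV $\lambda\mu$-calculus. (1) The call-by-value evaluation of $M$ terminates if and only if $\Gamma\vdash M:T\mid\Delta$ is derivable for some $\Gamma,\Delta,T$. (2) $M$ is normalizable if and only if $\Gamma\vdash M:T\mid\Delta$ is derivable for some $\Gamma,\Delta,T$ none of which contains $\omega$ or $\mho$ (occurrences of $\omega$, $\mho$ elsewhere in the derivation are allowed).
   Context: CCV $\lambda\mu$-calculus. Ordinary variables $x,y,z,\dots$ and continuation variables $k,l,m,\dots$ are disjoint. Terms $M ::= x \mid \lambda x.M \mid MM \mid (M\ \mathsf{where}\ x:=M) \mid \mu k.J$, jumps $J ::= [k]M \mid (J\ \mathsf{where}\ x:=M)$, where $(L\ \mathsf{where}\ x:=M)$ means $\mathsf{let}\ x=M\ \mathsf{in}\ L$ ($x$ bound in $L$ only). For reduction and typing, terms are identified up to $\alpha$-conversion and the congruence generated by (E1) $(L\ \mathsf{where}\ x:=(M\ \mathsf{where}\ y:=N))=((L\ \mathsf{where}\ x:=M)\ \mathsf{where}\ y:=N)$ if $y$ not free in $L$; (E2) $((\mu k.J)\ \mathsf{where}\ x:=M)=\mu k.(J\ \mathsf{where}\ x:=M)$ if $k$ not free in $M$; (E3) $[k](L\ \mathsf{where}\ x:=M)=([k]L\ \mathsf{where}\ x:=M)$. Values $V$: variables and $\lambda$-abstractions; $N$ a non-value. Reduction rules ($z$ fresh): $NM\to(zM\ \mathsf{where}\ z:=N)$; $VN\to(Vz\ \mathsf{where}\ z:=N)$; $(\lambda x.M)V\to(M\ \mathsf{where}\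 x:=V)$; $(M\ \mathsf{where}\ x:=V)\to M\{V/x\}$; $(M\ \mathsf{where}\ x:=\mu k.J)\to\mu k.J\{[k]\square\mapsto[k](M\ \mathsf{where}\ x:=\square)\}$; $[l]\mu k.J\to J\{l/k\}$; $\lambda x.Vx\to V$ ($x$ not free in $V$); $(x\ \mathsf{where}\ x:=M)\to M$; $\mu k.[k]M\to M$ ($k$ not free in $M$); the context substitution replaces recursively each subjump $[k]Q$ with $k$ free by $[k](M\ \mathsf{where}\ x:=Q)$, and $J\{l/k\}$ replaces each such $[k]Q$ by $[l]Q$. $M$ is normalizable if it reduces (compatible closure, finitely many steps) to a term containing no redex. Call-by-value evaluation: here terms are syntax trees up to $\alpha$-conversion with $[k](L\ \mathsf{where}\ x:=M)$ and $([k]L\ \mathsf{where}\ x:=M)$ identified (read as the former), (E1), (E2) not applied. Evaluation contexts $E ::= \square \mid E[V\square] \mid E[\square M] \mid E[(M\ \mathsf{where}\ x:=\square)]$. $E_0$-rewriting: $E[(\mu k.J)M]\to E[(zM\ \mathsf{where}\ z:=\mu k.J)]$; $E[V(\mu k.J)]\to E[(Vz\ \mathsf{where}\ z:=\mu k.J)]$; $E[(\lambda x.M)V]\to E[(M\ \mathsf{where}\ x:=V)]$; $E[(M\ \mathsf{where}\ x:=V)]\to E[M\{V/x\}]$; $E[(M\ \mathsf{where}\ x:=\mu k.J)]\to E[\mu k.J\{[k]\square\mapsto[k](M\ \mathsf{where}\ x:=\square)\}]$. $E$-rewriting: $\mu k.[l]\mu m.J\to_E\mu k.J\{l/m\}$;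 $L\to_{E_0}M$ implies $L\to_E M$ and $\mu k.[l]L\to_E\mu k.[l]M$. The evaluation of $M$ terminates if $M\to_E^*N$ with no $E$-rewriting applicable to $N$. Types: raw $R ::= \alpha \mid S\rightarrow T$ ($\alpha$ atomic); subsidiary $S ::= \bigcap R$ (finite intersection, empty one $\omega$); types $T ::= \bigcup S$ (finite union, empty one $\mho$); modulo associativity/commutativity; raw types are one-element intersections, subsidiary types one-element unions. Subtyping: $\alpha\leq\alpha$; $S'\leq S$, $T\leq T'$ give $S\rightarrow T\leq S'\rightarrow T'$; $S\leq S'$ gives $S\cap S''\leq S'$; $S\leq S_i$ ($\forall i$) gives $S\leq\bigcap_iS_i$; $T\leq T'$ gives $T\leq T''\cup T'$; $T_i\leq T$ ($\forall i$) gives $\bigcup_iT_i\leq T$. Judgements $\Gamma\vdash M:T\mid\Delta$, $\Gamma\vdash J:\bot\mid\Delta$ ($\Gamma$: subsidiary types for distinct ordinary variables; $\Delta$: types for distinct continuation variables; $\bot$ special type of jumps). Rules (finite, possibly empty index sets): $\Gamma,x:S\vdash x:S\mid\Delta$; if $\Gamma,x:S_i\vdash M:T_i\mid\Delta$ for all $i$ then $\Gamma\vdash\lambda x.M:\bigcap_i(S_i\rightarrow T_i)\mid\Delta$; if $\Gamma\vdash M:\bigcup_{i}\bigcap_{j\in J(i)}(S_{ij}\rightarrow T)\mid\Delta$ and $\Gamma\vdash N:\bigcup_{j\in J(i)}S_{ij}\mid\Delta$ for all $i$ then $\Gamma\vdash MN:T\mid\Delta$; if $\Gamma,x:S_i\vdash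 M:T\mid\Delta$ for all $i$ and $\Gamma\vdash N:\bigcup_iS_i\mid\Delta$ then $\Gamma\vdash(M\ \mathsf{where}\ x:=N):T\mid\Delta$; if $\Gamma\vdash J:\bot\mid\Delta,k:T$ then $\Gamma\vdash\mu k.J:T\mid\Delta$; if $\Gamma\vdash M:T\mid\Delta,k:T$ then $\Gamma\vdash[k]M:\bot\mid\Delta,k:T$; if $\Gamma,x:S_i\vdash J:\bot\mid\Delta$ for all $i$ and $\Gamma\vdash N:\bigcup_iS_i\mid\Delta$ then $\Gamma\vdash(J\ \mathsf{where}\ x:=N):\bot\mid\Delta$; if $\Gamma\vdash M:T\mid\Delta$ and $T\leq T'$ then $\Gamma\vdash M:T'\mid\Delta$. *)

(* Defs.v *)
From Stdlib Require Import List Bool Arith Relations.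
Import ListNotations.

(* Syntax, de Bruijn indices (alpha-conversion is built in).
   Two separate index spaces: ordinary variables and continuation vars.
   - [Lam M] binds ordinary index 0 in M;
   - [WhereT L N] is (L where x := N), x = ordinary index 0 bound in L only;
   - [Mu J] binds continuation index 0 in J;
   - [Jmp k M] is [k]M;
   - [WhereJ J N] is (J where x := N), x bound in J only. *)
Inductive term : Type :=
| Var : nat -> term
| Lam : term -> term
| App : term -> term -> term
| WhereT : term -> term -> term
| Mu : jump -> term
with jump : Type :=
| Jmp : nat -> term -> jump
| WhereJ : jump -> term -> jump.

Definition is_value (M : term) : bool :=
  match M with Var _ | Lam _ => true | _ => false end.

Definition upren (xi : nat -> nat) : nat -> nat :=
  fun i => match i with 0 => 0 | S i => S (xi i) end.

Fixpoint ren_o (xi : nat -> nat) (M : term) : term :=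
  match M with
  | Var x => Var (xi x)
  | Lam M => Lam (ren_o (upren xi) M)
  | App M N => App (ren_o xi M) (ren_o xi N)
  | WhereT L N => WhereT (ren_o (upren xi) L) (ren_o xi N)
  | Mu J => Mu (ren_oj xi J)
  end
with ren_oj (xi : nat -> nat) (J : jump) : jump :=
  match J with
  | Jmp k M => Jmp k (ren_o xi M)
  | WhereJ J N => WhereJ (ren_oj (upren xi) J) (ren_o xi N)
  end.

Fixpoint ren_c (xi : nat -> nat) (M : term) : term :=
  match M with
  | Var x => Var x
  | Lam M => Lam (ren_c xi M)
  | App M N => App (ren_c xi M) (ren_c xi N)
  | WhereT L N => WhereT (ren_c xi L) (ren_c xi N)
  | Mu J => Mu (ren_cj (upren xi) J)
  end
with ren_cj (xi : nat -> nat) (J : jump) : jump :=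
  match J with
  | Jmp k M => Jmp (xi k) (ren_c xi M)
  | WhereJ J N => WhereJ (ren_cj xi J) (ren_c xi N)
  end.

Definition up_o (sigma : nat -> term) : nat -> term :=
  fun i => match i with 0 => Var 0 | S i => ren_o S (sigma i) end.
Definition up_c (sigma : nat -> term) : nat -> term :=
  fun i => ren_c S (sigma i).

Fixpoint subst_o (sigma : nat -> term) (M : term) : term :=
  match M with
  | Var x => sigma x
  | Lam M => Lam (subst_o (up_o sigma) M)
  | App M N => App (subst_o sigma M) (subst_o sigma N)
  | WhereT L N => WhereT (subst_o (up_o sigma) L) (subst_o sigma N)
  | Mu J => Mu (subst_oj (up_c sigma) J)
  end
with subst_oj (sigma : nat -> term) (J : jump) : jump :=
  match J with
  | Jmp k M => Jmp k (subst_o sigma M)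
  | WhereJ J N => WhereJ (subst_oj (up_o sigma) J) (subst_o sigma N)
  end.

Definition subst1 (V : term) : nat -> term :=
  fun i => match i with 0 => V | S i => Var i end.

Definition csub1 (l : nat) : nat -> nat :=
  fun i => match i with 0 => l | S i => i end.

(* Structural (context) substitution
   X{[k]box |-> [k](P where x := box)}, where P has x as ordinary index 0.
   Recursively replaces every subjump [k]Q (k free) by [k](P where x:=Q'). *)
Fixpoint cs_t (k : nat) (P : term) (M : term) : term :=
  match M with
  | Var x => Var x
  | Lam M => Lam (cs_t k (ren_o (upren S) P) M)
  | App M N => App (cs_t k P M) (cs_t k P N)
  | WhereT L N => WhereT (cs_t k (ren_o (upren S) P) L) (cs_t k P N)
  | Mu J => Mu (cs_j (S k) (ren_c S P) J)
  end
with cs_j (k : nat) (P : term) (J : jump) : jump :=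
  match J with
  | Jmp l Q => if Nat.eqb l k then Jmp l (WhereT P (cs_t k P Q))
               else Jmp l (cs_t k P Q)
  | WhereJ J N => WhereJ (cs_j k (ren_o (upren S) P) J) (cs_t k P N)
  end.

Inductive ceq1_t : term -> term -> Prop :=
| E1_t L M N :
    ceq1_t (WhereT L (WhereT M N)) (WhereT (WhereT (ren_o (upren S) L) M) N)
| E2 J M : ceq1_t (WhereT (Mu J) M) (Mu (WhereJ J (ren_c S M)))
| ceq_lam M M' : ceq1_t M M' -> ceq1_t (Lam M) (Lam M')
| ceq_appl M M' N : ceq1_t M M' -> ceq1_t (App M N) (App M' N)
| ceq_appr M N N' : ceq1_t N N' -> ceq1_t (App M N) (App M N')
| ceq_wherel L L' N : ceq1_t L L' -> ceq1_t (WhereT L N) (WhereT L' N)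
| ceq_wherer L N N' : ceq1_t N N' -> ceq1_t (WhereT L N) (WhereT L N')
| ceq_mu J J' : ceq1_j J J' -> ceq1_t (Mu J) (Mu J')
with ceq1_j : jump -> jump -> Prop :=
| E1_j J M N :
    ceq1_j (WhereJ J (WhereT M N)) (WhereJ (WhereJ (ren_oj (upren S) J) M) N)
| E3 k L M : ceq1_j (Jmp k (WhereT L M)) (WhereJ (Jmp k L) M)
| ceqj_jmp k M M' : ceq1_t M M' -> ceq1_j (Jmp k M) (Jmp k M')
| ceqj_wherel J J' N : ceq1_j J J' -> ceq1_j (WhereJ J N) (WhereJ J' N)
| ceqj_wherer J N N' : ceq1_t N N' -> ceq1_j (WhereJ J N) (WhereJ J N').

Definition tm_equiv : term -> term -> Prop := clos_refl_sym_trans term ceq1_t.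
Definition jm_equiv : jump -> jump -> Prop := clos_refl_sym_trans jump ceq1_j.

Inductive step_t : term -> term -> Prop :=
| R_app_l N M : is_value N = false ->
    step_t (App N M) (WhereT (App (Var 0) (ren_o S M)) N)
| R_app_r V N : is_value V = true -> is_value N = false ->
    step_t (App V N) (WhereT (App (ren_o S V) (Var 0)) N)
| R_beta M V : is_value V = true -> step_t (App (Lam M) V) (WhereT M V)
| R_where_val M V : is_value V = true ->
    step_t (WhereT M V) (subst_o (subst1 V) M)
| R_where_mu M J :
    step_t (WhereT M (Mu J)) (Mu (cs_j 0 (ren_c S M) J))
| R_eta V : is_value V = true -> step_t (Lam (App (ren_o S V) (Var 0))) V
| R_where_var M : step_t (WhereT (Var 0) M) M
| R_mu_jmp M : step_t (Mu (Jmp 0 (ren_c S M))) M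
| S_lam M M' : step_t M M' -> step_t (Lam M) (Lam M')
| S_appl M M' N : step_t M M' -> step_t (App M N) (App M' N)
| S_appr M N N' : step_t N N' -> step_t (App M N) (App M N')
| S_wherel L L' N : step_t L L' -> step_t (WhereT L N) (WhereT L' N)
| S_wherer L N N' : step_t N N' -> step_t (WhereT L N) (WhereT L N')
| S_mu J J' : step_j J J' -> step_t (Mu J) (Mu J')
with step_j : jump -> jump -> Prop :=
| R_jmp_mu l J : step_j (Jmp l (Mu J)) (ren_cj (csub1 l) J)
| Sj_jmp k M M' : step_t M M' -> step_j (Jmp k M) (Jmp k M')
| Sj_wherel J J' N : step_j J J' -> step_j (WhereJ J N) (WhereJ J' N)
| Sj_wherer J N N' : step_t N N' -> step_j (WhereJ J N) (WhereJ J N').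

Definition red1 (M N : term) : Prop :=
  exists M' N', tm_equiv M M' /\ tm_equiv N N' /\ step_t M' N'.

Definition normalizable (M : term) : Prop :=
  exists N, clos_refl_trans term red1 M N /\ ~ (exists N', red1 N N').

(* Call-by-value evaluation.  Syntax trees with (E3) read left-to-right:
   ([k]L where x:=M) is read as [k](L where x:=M); [e3_t] computes that
   canonical reading of every subterm. *)
Fixpoint e3_t (M : term) : term :=
  match M with
  | Var x => Var x
  | Lam M => Lam (e3_t M)
  | App M N => App (e3_t M) (e3_t N)
  | WhereT L N => WhereT (e3_t L) (e3_t N)
  | Mu J => let '(k, L) := e3_j J in Mu (Jmp k L)
  end
with e3_j (J : jump) : nat * term :=
  match J with
  | Jmp k M => (k, e3_t M)
  | WhereJ J N => let '(k, L) := e3_j J in (k, WhereT L (e3_t N))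
  end.

Inductive e0_step : term -> term -> Prop :=
| E0_mu_app J M :
    e0_step (App (Mu J) M) (WhereT (App (Var 0) (ren_o S M)) (Mu J))
| E0_val_mu V J : is_value V = true ->
    e0_step (App V (Mu J)) (WhereT (App (ren_o S V) (Var 0)) (Mu J))
| E0_beta M V : is_value V = true -> e0_step (App (Lam M) V) (WhereT M V)
| E0_where_val M V : is_value V = true ->
    e0_step (WhereT M V) (subst_o (subst1 V) M)
| E0_where_mu M J :
    e0_step (WhereT M (Mu J)) (Mu (cs_j 0 (ren_c S M) J))
| E0_ctx_fun M M' N : e0_step M M' -> e0_step (App M N) (App M' N)
| E0_ctx_arg V N N' : is_value V = true -> e0_step N N' ->
    e0_step (App V N) (App V N')
| E0_ctx_where M N N' : e0_step N N' -> e0_step (WhereT M N) (WhereT M N').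

Inductive e_step : term -> term -> Prop :=
| E_mu_mu l J : e_step (Mu (Jmp l (Mu J))) (Mu (ren_cj (csub1 l) J))
| E_e0 L M : e0_step L M -> e_step L M
| E_under L M l : e0_step L M -> e_step (Mu (Jmp l L)) (Mu (Jmp l M)).

Definition cbv_terminates (M : term) : Prop :=
  exists N, clos_refl_trans term e_step (e3_t M) N /\ ~ (exists N', e_step N N').

(* Types.  Raw R ::= alpha | S -> T; subsidiary S = finite intersection of
   raw types (a list; [] = omega); type T = finite union of subsidiary types
   (a list; [] = mho).  Associativity/commutativity handled by [req/seqv/teqv]
   (list permutation, recursively). *)
Inductive raw : Type :=
| Atom : nat -> raw
| Arr : list raw -> list (list raw) -> raw.
Notation sub := (list raw).
Notation ty := (list (list raw)).

Inductive req : raw -> raw -> Prop :=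
| req_atom a : req (Atom a) (Atom a)
| req_arr S S' T T' : seqv S S' -> teqv T T' -> req (Arr S T) (Arr S' T')
with seqv : sub -> sub -> Prop :=
| seqv_nil : seqv [] []
| seqv_cons r r' S S' : req r r' -> seqv S S' -> seqv (r :: S) (r' :: S')
| seqv_swap r1 r2 S : seqv (r1 :: r2 :: S) (r2 :: r1 :: S)
| seqv_trans S1 S2 S3 : seqv S1 S2 -> seqv S2 S3 -> seqv S1 S3
with teqv : ty -> ty -> Prop :=
| teqv_nil : teqv [] []
| teqv_cons s s' T T' : seqv s s' -> teqv T T' -> teqv (s :: T) (s' :: T')
| teqv_swap s1 s2 T : teqv (s1 :: s2 :: T) (s2 :: s1 :: T)
| teqv_trans T1 T2 T3 : teqv T1 T2 -> teqv T2 T3 -> teqv T1 T3.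

(* Subtyping; raw types are one-element intersections, subsidiary types
   one-element unions. *)
Inductive le : ty -> ty -> Prop :=
| le_atom a : le [[Atom a]] [[Atom a]]
| le_arr S S' T T' : le [S'] [S] -> le T T' -> le [[Arr S T]] [[Arr S' T']]
| le_capl S S' S'' : le [S] [S'] -> le [S ++ S''] [S']
| le_capr S (Ss : list sub) : (forall Si, In Si Ss -> le [S] [Si]) ->
    le [S] [concat Ss]
| le_cupl T T' T'' : le T T' -> le T (T'' ++ T')
| le_cupr (Ts : list ty) T : (forall Ti, In Ti Ts -> le Ti T) -> le (concat Ts) T
| le_ac T1 T2 T1' T2' : le T1 T2 -> teqv T1 T1' -> teqv T2 T2' -> le T1' T2'.

(* Contexts: Gamma assigns subsidiary types to ordinary de Bruijn indices,
   Delta assigns types to continuation indices ([None] = not declared). *)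
Definition ctx := list (option sub).
Definition dctx := list (option ty).

Definition opt_rel {A : Type} (R : A -> A -> Prop) (x y : option A) : Prop :=
  match x, y with
  | None, None => True
  | Some a, Some b => R a b
  | _, _ => False
  end.
Definition ctx_eq (G G' : ctx) : Prop := Forall2 (opt_rel seqv) G G'.
Definition dctx_eq (D D' : dctx) : Prop := Forall2 (opt_rel teqv) D D'.

Inductive typ : ctx -> dctx -> term -> ty -> Prop :=
| T_var G D x S : nth_error G x = Some (Some S) -> typ G D (Var x) [S]
| T_lam G D M (ST : list (sub * ty)) :
    (forall p, In p ST -> typ (Some (fst p) :: G) D M (snd p)) ->
    typ G D (Lam M) [map (fun p => Arr (fst p) (snd p)) ST]
| T_app G D M N T (SS : list (list sub)) :
    typ G D M (map (fun Si => map (fun s => Arr s T) Si) SS) ->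
    (forall Si, In Si SS -> typ G D N Si) ->
    typ G D (App M N) T
| T_where G D L N T (Ss : list sub) :
    (forall S, In S Ss -> typ (Some S :: G) D L T) ->
    typ G D N Ss ->
    typ G D (WhereT L N) T
| T_mu G D J T : jtyp G (Some T :: D) J -> typ G D (Mu J) T
| T_sub G D M T T' : typ G D M T -> le T T' -> typ G D M T'
| T_conv G G' D D' M M' T T' : typ G D M T -> ctx_eq G G' -> dctx_eq D D' ->
    tm_equiv M M' -> teqv T T' -> typ G' D' M' T'
with jtyp : ctx -> dctx -> jump -> Prop :=
| J_jmp G D k M T : nth_error D k = Some (Some T) -> typ G D M T ->
    jtyp G D (Jmp k M)
| J_where G D J N (Ss : list sub) :
    (forall S, In S Ss -> jtyp (Some S :: G) D J) ->
    typ G D N Ss ->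
    jtyp G D (WhereJ J N)
| J_conv G G' D D' J J' : jtyp G D J -> ctx_eq G G' -> dctx_eq D D' ->
    jm_equiv J J' -> jtyp G' D' J'.

(* occurrences of omega (empty intersection) or mho (empty union) *)
Definition nilb {A : Type} (l : list A) : bool :=
  match l with [] => true | _ => false end.

Fixpoint raw_bad (r : raw) : bool :=
  match r with
  | Atom _ => false
  | Arr Sd Td =>
      nilb Sd || existsb raw_bad Sd ||
      nilb Td || existsb (fun s => nilb s || existsb raw_bad s) Td
  end.
Definition sub_bad (S : sub) : bool := nilb S || existsb raw_bad S.
Definition ty_bad (T : ty) : bool := nilb T || existsb sub_bad T.

Definition ctx_ok (G : ctx) : Prop :=
  forall x S, nth_error G x = Some (Some S) -> sub_bad S = false.
Definition dctx_ok (D : dctx) : Prop :=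
  forall k T, nth_error D k = Some (Some T) -> ty_bad T = false.

(* Main.v *)
(** A jump whose continuation variables are instantiated by continuations behaves
    like a term of a small continuation-passing calculus [tm], in which every step
    is a substitution at the root.  Types are interpreted by realizability in this
    calculus: with a pole of terminating (respectively normalizing) target terms, a
    typable source term has a terminating translation, and a term typable without omega and
    mho has a normalizing one, since such types contain all variables and only
    normalizing realizers.  Termination is then transported back along the
    translation [C]: an evaluation step of the source either makes a step in the
    target or leaves the translation unchanged and decreases a lexicographic measure.

    Conversely, typing is given by a recursive predicate [den] on terms which is
    invariant under (E1)-(E3) and closed under expansion, up to replacing each atom
    [a] by [a -> a] because of the rule [R_eta]; blocked terms of the evaluation are
    typable, and normal forms are typable without omega and mho. *)

From Stdlib Require Import List Bool Arith Relations Lia Permutation.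
From Stdlib Require Import FunctionalExtensionality Classical.
Import ListNotations.
Require Import Defs.

(** * Subtyping *)

(** Only expansion of typing is proved. Realizability takes the place of subject reduction, so that
    one adequacy lemma, read with two poles, serves both statements. Declarative derivations resist
    inversion, since conversion and subsumption may end any of them, and reduction modulo (E1)-(E3)
    resists case analysis; hence the recursive [den] and the congruence invariants [tail] and
    [size]. Intersections gather the uses of a variable and, dually, unions gather the uses of a
    continuation: this is how ordinary and context substitution are undone. The translation treats
    values in application position specially so that naming an operator or argument, (E1) and
    binding a [Mu] preserve it literally and not only up to target steps; a bound on target steps
    then passes to the source term without any standardization argument. For normalization,
    induction on a derivation of [wn] for the translation builds the source reduction, and the eta
    rules are postponed: on terms normal for the other rules they only shrink the term. *)

Fixpoint raw_nested_ind (P : raw -> Prop) (HA : forall a, P (Atom a))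
  (HR : forall S0 T, (forall r, In r S0 -> P r) ->
     (forall s, In s T -> forall r, In r s -> P r) -> P (Arr S0 T))
  (r : raw) : P r :=
  let fix onsub (s : sub) : forall r, In r s -> P r :=
    match s with
    | [] => fun r (H : False) => match H with end
    | a :: s' => fun r H => match H with
        | or_introl e => eq_ind a P (raw_nested_ind P HA HR a) r e
        | or_intror H' => onsub s' r H' end
    end in
  let fix onty (T : ty) : forall s, In s T -> forall r, In r s -> P r :=
    match T with
    | [] => fun s (H : False) => match H with end
    | a :: T' => fun s H => match H with
        | or_introl e => eq_ind a (fun s => forall r, In r s -> P r) (onsub a) s e
        | or_intror H' => onty T' s H' end
    end in
  match r with
  | Atom a => HA a
  | Arr S0 T => HR S0 T (onsub S0) (onty T)
  end.

(** Syntax-directed subtyping, with associativity and commutativity absorbed by membership. The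
    premises of [rle_arr] are [sle S' S] and [tle T T'] unfolded. Unlike [le], whose rule [le_ac]
    matches every conclusion, it can be inverted. *)
Inductive rle : raw -> raw -> Prop :=
| rle_atom a : rle (Atom a) (Atom a)
| rle_arr S S' T T' :
    (forall r, In r S -> exists r', In r' S' /\ rle r' r) ->
    (forall s, In s T -> exists s', In s' T' /\
       forall r', In r' s' -> exists r, In r s /\ rle r r') ->
    rle (Arr S T) (Arr S' T').

Definition sle (S S' : sub) : Prop :=
  forall r', In r' S' -> exists r, In r S /\ rle r r'.
Definition tle (T T' : ty) : Prop :=
  forall s, In s T -> exists s', In s' T' /\ sle s s'.

Lemma rle_refl r : rle r r.
Proof.
  induction r as [a | S T IHS IHT] using raw_nested_ind; constructor; eauto.
  intros s Hs; exists s; split; eauto.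
Qed.

(** Induction on the middle type; the outer two exchange roles in the domain of an arrow and are
    therefore quantified inside. *)
Lemma rle_trans b : forall a c, rle a b -> rle b c -> rle a c.
Proof.
  induction b as [a | S T IHS IHT] using raw_nested_ind; intros x y H1 H2.
  - inversion H1; subst; exact H2.
  - inversion H1 as [| S0 ? T0 ? A1 A2]; subst.
    inversion H2 as [| ? S1 ? T1 B1 B2]; subst. constructor.
    + intros r Hr. destruct (A1 r Hr) as (r1 & I1 & ?).
      destruct (B1 r1 I1) as (r2 & ? & ?). eauto.
    + intros s Hs. destruct (A2 s Hs) as (s1 & I1 & L1).
      destruct (B2 s1 I1) as (s2 & I2 & L2). exists s2; split; auto.
      intros r' Hr'. destruct (L2 r' Hr') as (r1 & I3 & ?).
      destruct (L1 r1 I3) as (r2 & ? & ?). eauto.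
Qed.

Lemma sle_refl S : sle S S.
Proof. intros r Hr; exists r; split; auto using rle_refl. Qed.

Lemma sle_trans S1 S2 S3 : sle S1 S2 -> sle S2 S3 -> sle S1 S3.
Proof.
  intros H1 H2 r Hr. destruct (H2 r Hr) as (r1 & I & L).
  destruct (H1 r1 I) as (r2 & ? & ?). eauto using rle_trans.
Qed.

Lemma tle_refl T : tle T T.
Proof. intros s Hs; exists s; split; auto using sle_refl. Qed.

Lemma tle_trans T1 T2 T3 : tle T1 T2 -> tle T2 T3 -> tle T1 T3.
Proof.
  intros H1 H2 s Hs. destruct (H1 s Hs) as (s1 & I & L).
  destruct (H2 s1 I) as (s2 & ? & ?). eauto using sle_trans.
Qed.

Lemma sle_incl S S' : incl S' S -> sle S S'.
Proof. intros H r Hr; exists r; split; auto using rle_refl. Qed.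

Lemma tle_incl T T' : incl T T' -> tle T T'.
Proof. intros H s Hs; exists s; split; auto using sle_refl. Qed.

Lemma rle_Arr S S' T T' : sle S' S -> tle T T' -> rle (Arr S T) (Arr S' T').
Proof. intros H1 H2; constructor; [exact H1 | exact H2]. Qed.

Scheme req_mind := Minimality for req Sort Prop
with seqv_mind := Minimality for seqv Sort Prop
with teqv_mind := Minimality for teqv Sort Prop.
Combined Scheme eqv_mind from req_mind, seqv_mind, teqv_mind.

Lemma eqv_le :
  (forall r r', req r r' -> rle r r' /\ rle r' r) /\
  (forall S S', seqv S S' -> sle S S' /\ sle S' S) /\
  (forall T T', teqv T T' -> tle T T' /\ tle T' T).
Proof.
  apply eqv_mind; intros.
  - split; constructor.
  - destruct H0, H2; split; apply rle_Arr; auto.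
  - split; apply sle_refl.
  - destruct H0, H2; split; intros x [<- | Hx].
    + exists r; simpl; auto.
    + destruct (H2 x Hx) as (y & ? & ?). exists y; simpl; auto.
    + exists r'; simpl; auto.
    + destruct (H4 x Hx) as (y & ? & ?). exists y; simpl; auto.
  - split; apply sle_incl; intros x; simpl; tauto.
  - destruct H0, H2; split; eauto using sle_trans.
  - split; apply tle_refl.
  - destruct H0, H2; split; intros x [<- | Hx].
    + exists s'; simpl; auto.
    + destruct (H2 x Hx) as (y & ? & ?). exists y; simpl; auto.
    + exists s; simpl; auto.
    + destruct (H4 x Hx) as (y & ? & ?). exists y; simpl; auto.
  - split; apply tle_incl; intros x; simpl; tauto.
  - destruct H0, H2; split; eauto using tle_trans.
Qed.

(** Together with [tle_le], this identifies the declarative relation with the syntax-directed one.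
    Equivalence by [teqv] is subtyping in both directions, so [le_ac] is an instance of
    transitivity. *)
Lemma le_tle T T' : le T T' -> tle T T'.
Proof.
  assert (K : forall S S', tle [S] [S'] -> sle S S').
  { intros S S' H. destruct (H S (or_introl eq_refl)) as (s' & [<- | []] & ?); auto. }
  assert (K' : forall S S', sle S S' -> tle [S] [S']).
  { intros S S' H s [<- | []]. exists S'; simpl; auto. }
  induction 1.
  - apply tle_refl.
  - apply K'. intros r [<- | []]. eexists; split; [left; reflexivity |].
    apply rle_Arr; auto.
  - apply K'. apply K in IHle. eapply sle_trans; [| exact IHle].
    apply sle_incl, incl_appl, incl_refl.
  - apply K'. intros r Hr. apply in_concat in Hr. destruct Hr as (Si & H1 & H2).
    exact (K _ _ (H0 Si H1) r H2).
  - eapply tle_trans; [exact IHle |]. apply tle_incl, incl_appr, incl_refl.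
  - intros s Hs. apply in_concat in Hs. destruct Hs as (Ti & H1 & H2).
    exact (H0 Ti H1 s H2).
  - destruct eqv_le as (_ & _ & E). apply E in H0, H1.
    eapply tle_trans; [apply H0 |]. eapply tle_trans; [exact IHle | apply H1].
Qed.

Lemma eqv_refl :
  (forall r, req r r) /\ (forall S, seqv S S) /\ (forall T, teqv T T).
Proof.
  assert (A : forall S, (forall r, In r S -> req r r) -> seqv S S).
  { induction S; intros; constructor; simpl in *; auto. }
  assert (B : forall T, (forall s, In s T -> seqv s s) -> teqv T T).
  { induction T; intros; constructor; simpl in *; auto. }
  assert (C : forall r, req r r).
  { induction r using raw_nested_ind; constructor; auto.
    apply B. intros s Hs. apply A. eauto. }
  auto.
Qed.

Lemma seqv_perm S S' : Permutation S S' -> seqv S S'.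
Proof.
  destruct eqv_refl as (? & ? & ?).
  induction 1; [constructor | constructor; auto | apply seqv_swap |].
  eapply seqv_trans; eauto.
Qed.

Lemma teqv_perm T T' : Permutation T T' -> teqv T T'.
Proof.
  destruct eqv_refl as (? & ? & ?).
  induction 1; [constructor | constructor; auto | apply teqv_swap |].
  eapply teqv_trans; eauto.
Qed.

(** The target is cut into singletons for [le_capr]; for each of them the chosen component is
    permuted to the front, where [le_capl] can find it. *)
Lemma le_of_sub S S' :
  (forall r', In r' S' -> exists r, In r S /\ le [[r]] [[r']]) -> le [S] [S'].
Proof.
  intros H. destruct eqv_refl as (? & ? & ?).
  replace S' with (concat (map (fun r => [r]) S')).
  2:{ clear H. induction S'; simpl; congruence. }
  apply le_capr. intros Si HSi. apply in_map_iff in HSi.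
  destruct HSi as (r' & <- & Hr'). destruct (H r' Hr') as (r & Hr & L).
  apply in_split in Hr. destruct Hr as (l1 & l2 & ->).
  eapply le_ac; [apply (le_capl [r] [r'] (l1 ++ l2) L) | | auto].
  constructor; [| constructor]. apply seqv_perm. simpl. apply Permutation_middle.
Qed.

Lemma le_of_ty T T' :
  (forall s, In s T -> exists s', In s' T' /\ le [s] [s']) -> le T T'.
Proof.
  intros H. destruct eqv_refl as (? & ? & ?).
  replace T with (concat (map (fun s => [s]) T)).
  2:{ clear H. induction T; simpl; congruence. }
  apply le_cupr. intros Ti HTi. apply in_map_iff in HTi.
  destruct HTi as (s & <- & Hs). destruct (H s Hs) as (s' & Hs' & L).
  apply in_split in Hs'. destruct Hs' as (l1 & l2 & ->).
  eapply le_ac; [apply (le_cupl [s] [s'] (l1 ++ l2) L) | auto |].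
  apply teqv_perm. rewrite <- app_assoc. apply Permutation_app_head.
  apply Permutation_sym, Permutation_cons_append.
Qed.

(** Both directions are proved together because the induction runs over only one of the two types,
    and contravariance of the domain swaps the side on which it stands. The same device recurs in
    [rle_asub] and [vint_rle]. *)
Lemma rle_le r : (forall r', rle r r' -> le [[r]] [[r']]) /\
                 (forall r', rle r' r -> le [[r']] [[r]]).
Proof.
  induction r as [a | S T IHS IHT] using raw_nested_ind; split; intros r' H;
    inversion H as [| S1 S2 T1 T2 A B]; subst; constructor.
  all: try (apply le_of_sub; intros r Hr; destruct (A r Hr) as (r1 & ? & ?);
    exists r1; split; auto;
    first [solve [eapply (fun h => proj1 (IHS _ h)); eauto]
          | solve [eapply (fun h => proj2 (IHS _ h)); eauto]]).
  all: apply le_of_ty; intros s Hs; destruct (B s Hs) as (s1 & ? & L);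
    exists s1; split; auto; apply le_of_sub; intros r Hr;
    destruct (L r Hr) as (r2 & ? & ?); exists r2; split; auto;
    first [solve [eapply (fun i h => proj1 (IHT _ i _ h)); eauto]
          | solve [eapply (fun i h => proj2 (IHT _ i _ h)); eauto]].
Qed.

Lemma tle_le T T' : tle T T' -> le T T'.
Proof.
  intros H. apply le_of_ty. intros s Hs. destruct (H s Hs) as (s' & ? & L).
  exists s'; split; auto. apply le_of_sub. intros r Hr.
  destruct (L r Hr) as (r2 & ? & ?). exists r2; split; auto. apply rle_le; auto.
Qed.

(** * Typing by recursion on terms *)

Definition scons {A : Type} (a : A) (f : nat -> A) (n : nat) : A :=
  match n with 0 => a | S n => f n end.
Notation "a .: f" := (scons a f) (at level 55, right associativity).

Scheme term_mind := Induction for term Sort Prop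
with jump_mind := Induction for jump Sort Prop.
Combined Scheme term_jump_ind from term_mind, jump_mind.

(* Contexts are total, and subsumption is confined to the variable and
   application clauses, so that the generation lemmas hold by computation. *)
Fixpoint den (G : nat -> sub) (D : nat -> ty) (M : term) (T : ty) : Prop :=
  match M with
  | Var x => exists s, In s T /\ sle (G x) s
  | Lam M => exists s, In s T /\ forall r, In r s ->
      exists S1 T1, r = Arr S1 T1 /\ den (S1 .: G) D M T1
  | App M N => exists As, den G D M As /\ forall A, In A As ->
      exists Us, den G D N Us /\ forall U, In U Us -> sle A [Arr U T]
  | WhereT L N => exists Ss, den G D N Ss /\
      forall s, In s Ss -> den (s .: G) D L T
  | Mu J => denj G (T .: D) J
  end
with denj (G : nat -> sub) (D : nat -> ty) (J : jump) : Prop :=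
  match J with
  | Jmp k M => den G D M (D k)
  | WhereJ J N => exists Ss, den G D N Ss /\
      forall s, In s Ss -> denj (s .: G) D J
  end.

Definition gle (G G' : nat -> sub) : Prop := forall x, sle (G x) (G' x).
Definition dle (D D' : nat -> ty) : Prop := forall k, tle (D k) (D' k).

Lemma gle_refl G : gle G G.
Proof. intros x; apply sle_refl. Qed.

Lemma dle_refl D : dle D D.
Proof. intros x; apply tle_refl. Qed.

Lemma gle_scons s s' G G' : sle s s' -> gle G G' -> gle (s .: G) (s' .: G').
Proof. intros ? ? [|x]; simpl; auto. Qed.

Lemma dle_scons T T' D D' : tle T T' -> dle D D' -> dle (T .: D) (T' .: D').
Proof. intros ? ? [|x]; simpl; auto. Qed.

#[local] Hint Resolve sle_refl tle_refl gle_refl dle_refl gle_scons dle_scons : core.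

(** The two contexts vary oppositely: a smaller type strengthens an assumption on a variable,
    whereas a larger type lets a continuation accept more. *)
Lemma den_mono :
  (forall M G G' D D' T T', gle G' G -> dle D D' -> tle T T' ->
     den G D M T -> den G' D' M T') /\
  (forall J G G' D D', gle G' G -> dle D D' -> denj G D J -> denj G' D' J).
Proof.
  apply term_jump_ind; simpl.
  - intros x G G' D D' T T' HG HD HT (s & Hs & L).
    destruct (HT s Hs) as (s' & ? & ?). exists s'; split; auto.
    eauto using sle_trans.
  - intros M IH G G' D D' T T' HG HD HT (s & Hs & L).
    destruct (HT s Hs) as (s' & ? & L'). exists s'; split; auto.
    intros r Hr. destruct (L' r Hr) as (r0 & Hr0 & Hle).
    destruct (L r0 Hr0) as (S1 & T1 & -> & ?).
    inversion Hle as [| ? S2 ? T2 A B]; subst. exists S2, T2; split; auto.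
    eapply IH; [| | | eassumption]; auto.
  - intros M IHM N IHN G G' D D' T T' HG HD HT (As & H1 & H2).
    exists As; split; [eapply IHM; eauto |]. intros A HA.
    destruct (H2 A HA) as (Us & H3 & H4). exists Us; split; [eapply IHN; eauto |].
    intros U HU. eapply sle_trans; [apply (H4 U HU) |].
    intros r [<- | []]. eexists; split; [left; reflexivity |].
    apply rle_Arr; auto.
  - intros L IHL N IHN G G' D D' T T' HG HD HT (Ss & H1 & H2).
    exists Ss; split; [eapply IHN; eauto |]. intros s Hs.
    eapply IHL; [| | | apply H2]; auto.
  - intros J IH G G' D D' T T' HG HD HT H. eapply IH; [| | eassumption]; auto.
  - intros k M IH G G' D D' HG HD H. eapply IH; eauto.
  - intros J IHJ N IHN G G' D D' HG HD (Ss & H1 & H2).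
    exists Ss; split; [eapply IHN; eauto |]. intros s Hs.
    eapply IHJ; [| | apply H2]; auto.
Qed.

Lemma den_weaken G G' D D' T T' M : gle G' G -> dle D D' -> tle T T' ->
  den G D M T -> den G' D' M T'.
Proof. intros; eapply den_mono; eauto. Qed.

Lemma denj_weaken G G' D D' J : gle G' G -> dle D D' ->
  denj G D J -> denj G' D' J.
Proof. intros; eapply den_mono; eauto. Qed.

Lemma scons_upren A (a : A) f xi : (fun n => (a .: f) (upren xi n)) = a .: (fun n => f (xi n)).
Proof. extensionality n. destruct n; reflexivity. Qed.

Lemma den_ren_o :
  (forall M xi G D T, den G D (ren_o xi M) T <-> den (fun x => G (xi x)) D M T) /\
  (forall J xi G D, denj G D (ren_oj xi J) <-> denj (fun x => G (xi x)) D J).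
Proof.
  apply term_jump_ind; simpl; intros.
  - reflexivity.
  - setoid_rewrite H. setoid_rewrite scons_upren. reflexivity.
  - setoid_rewrite H. setoid_rewrite H0. reflexivity.
  - setoid_rewrite H. setoid_rewrite H0. setoid_rewrite scons_upren. reflexivity.
  - apply H.
  - apply H.
  - setoid_rewrite H. setoid_rewrite H0. setoid_rewrite scons_upren. reflexivity.
Qed.

Lemma den_ren_c :
  (forall M xi G D T, den G D (ren_c xi M) T <-> den G (fun x => D (xi x)) M T) /\
  (forall J xi G D, denj G D (ren_cj xi J) <-> denj G (fun x => D (xi x)) J).
Proof.
  apply term_jump_ind; simpl; intros.
  - reflexivity.
  - setoid_rewrite H. reflexivity.
  - setoid_rewrite H. setoid_rewrite H0. reflexivity.
  - setoid_rewrite H. setoid_rewrite H0. reflexivity.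
  - rewrite H, scons_upren. reflexivity.
  - apply H.
  - setoid_rewrite H. setoid_rewrite H0. reflexivity.
Qed.

Lemma den_shift_o M s G D T : den (s .: G) D (ren_o S M) T <-> den G D M T.
Proof. apply (proj1 den_ren_o M S). Qed.

Lemma den_shift_o1 M s s' G D T :
  den (s .: s' .: G) D (ren_o (upren S) M) T <-> den (s .: G) D M T.
Proof.
  rewrite (proj1 den_ren_o), scons_upren. reflexivity.
Qed.

Lemma denj_shift_o1 J s s' G D :
  denj (s .: s' .: G) D (ren_oj (upren S) J) <-> denj (s .: G) D J.
Proof.
  rewrite (proj2 den_ren_o), scons_upren. reflexivity.
Qed.

Lemma den_shift_c M U G D T : den G (U .: D) (ren_c S M) T <-> den G D M T.
Proof. apply (proj1 den_ren_c M S). Qed.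

Scheme ceq1_t_mind := Minimality for ceq1_t Sort Prop
with ceq1_j_mind := Minimality for ceq1_j Sort Prop.
Combined Scheme ceq1_ind from ceq1_t_mind, ceq1_j_mind.

(** Finitely many choices of a union type become one choice, their concatenation: [P] is monotone,
    and each member of the result remembers the [a] for which it was chosen. *)
Lemma merge_ty {A} (l : list A) (P : ty -> A -> Prop) (Q : sub -> A -> Prop) :
  (forall T T' a, tle T T' -> P T a -> P T' a) ->
  (forall a, In a l -> exists T, P T a /\ forall s, In s T -> Q s a) ->
  exists T, (forall a, In a l -> P T a) /\
            (forall s, In s T -> exists a, In a l /\ Q s a).
Proof.
  intros HP. induction l as [| a l IH]; intros H.
  - exists []. split; [intros a [] | intros s []].
  - destruct IH as (T1 & A1 & B1). { intros; apply H; simpl; auto. }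
    destruct (H a) as (T2 & A2 & B2); [simpl; auto |].
    exists (T1 ++ T2). split.
    + intros b [<- | Hb]; [apply (HP T2) | apply (HP T1)]; auto; apply tle_incl;
        auto using incl_appl, incl_appr, incl_refl.
    + intros s Hs. apply in_app_or in Hs. destruct Hs as [Hs | Hs].
      * destruct (B1 s Hs) as (b & ? & ?). exists b; simpl; auto.
      * exists a; simpl; auto.
Qed.

(** The two sides of (E2) and (E3) unfold to the same formula up to a shift. The content lies in
    (E1), where the type of [M] has to be made independent of the type of [N]. *)
Lemma den_ceq1 :
  (forall M M', ceq1_t M M' -> forall G D T, den G D M T <-> den G D M' T) /\
  (forall J J', ceq1_j J J' -> forall G D, denj G D J <-> denj G D J').
Proof.
  apply ceq1_ind; intros; simpl.
  - split.
    + intros (Ss & (Us & H1 & H2) & H3). exists Us; split; auto.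
      intros u Hu. exists Ss; split; auto. intros s Hs. apply den_shift_o1; auto.
    + intros (Us & H1 & H2).
      (* Read from right to left, (E1) gives [M] a type that depends on the member [u] chosen for
         [N]; the union over all [u] is uniform. [L] does not contain the variable typed by [u], so
         its typings survive the merge. *)
      destruct (merge_ty Us (fun T u => den (u .: G) D M T)
        (fun s u => den (s .: G) D L T)) as (Ss & A & B).
      * intros; eapply den_weaken; eauto.
      * intros u Hu. destruct (H2 u Hu) as (Ss & ? & H3).
        exists Ss; split; auto. intros s Hs. apply (den_shift_o1 L s u); auto.
      * exists Ss. split; [eauto |]. intros s Hs. destruct (B s Hs) as (? & _ & ?); auto.
  - setoid_rewrite den_shift_c. reflexivity.
  - setoid_rewrite H0. reflexivity.
  - setoid_rewrite H0. reflexivity.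
  - setoid_rewrite H0. reflexivity.
  - setoid_rewrite H0. reflexivity.
  - setoid_rewrite H0. reflexivity.
  - apply H0.
  - split.
    + intros (Ss & (Us & H1 & H2) & H3). exists Us; split; auto.
      intros u Hu. exists Ss; split; auto. intros s Hs. apply denj_shift_o1; auto.
    + intros (Us & H1 & H2).
      destruct (merge_ty Us (fun T u => den (u .: G) D M T)
        (fun s u => denj (s .: G) D J)) as (Ss & A & B).
      * intros; eapply den_weaken; eauto.
      * intros u Hu. destruct (H2 u Hu) as (Ss & ? & H3).
        exists Ss; split; auto. intros s Hs. apply (denj_shift_o1 J s u); auto.
      * exists Ss. split; [eauto |]. intros s Hs. destruct (B s Hs) as (? & _ & ?); auto.
  - reflexivity.
  - apply H0.
  - setoid_rewrite H0. reflexivity.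
  - setoid_rewrite H0. reflexivity.
Qed.

Lemma den_equiv M M' : tm_equiv M M' -> forall G D T, den G D M T <-> den G D M' T.
Proof.
  induction 1; intros.
  - apply den_ceq1; auto.
  - reflexivity.
  - symmetry; auto.
  - etransitivity; eauto.
Qed.

Lemma denj_equiv J J' : jm_equiv J J' -> forall G D, denj G D J <-> denj G D J'.
Proof.
  induction 1; intros.
  - apply den_ceq1; auto.
  - reflexivity.
  - symmetry; auto.
  - etransitivity; eauto.
Qed.

(** * From derivations to the recursive typing *)

Definition ctx_ext (G : ctx) (g : nat -> sub) : Prop :=
  forall x s, nth_error G x = Some (Some s) -> sle (g x) s.
Definition dctx_ext (D : dctx) (d : nat -> ty) : Prop :=
  forall k T, nth_error D k = Some (Some T) -> tle T (d k).

Lemma ctx_ext_cons G g s : ctx_ext G g -> ctx_ext (Some s :: G) (s .: g).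
Proof. intros H [| x] s' E; simpl in *; [injection E as -> |]; auto. Qed.

Lemma dctx_ext_cons D d T : dctx_ext D d -> dctx_ext (Some T :: D) (T .: d).
Proof. intros H [| x] s' E; simpl in *; [injection E as -> |]; auto. Qed.

Lemma Forall2_nth_error_Some {A B} (R : A -> B -> Prop) l l' : Forall2 R l l' ->
  forall n a, nth_error l n = Some a ->
  exists b, nth_error l' n = Some b /\ R a b.
Proof.
  induction 1; intros [| n] a E; simpl in *; try discriminate; eauto.
  injection E as <-; eauto.
Qed.

Lemma ctx_ext_eq G G' g : ctx_eq G G' -> ctx_ext G' g -> ctx_ext G g.
Proof.
  intros HE H x s E. destruct (Forall2_nth_error_Some _ _ _ HE _ _ E) as ([s'|] & E' & R);
    simpl in R; [| tauto].
  eapply sle_trans; [apply H, E' |]. apply eqv_le in R. apply R.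
Qed.

Lemma dctx_ext_eq D D' d : dctx_eq D D' -> dctx_ext D' d -> dctx_ext D d.
Proof.
  intros HE H x s E. destruct (Forall2_nth_error_Some _ _ _ HE _ _ E) as ([s'|] & E' & R);
    simpl in R; [| tauto].
  eapply tle_trans; [| apply H, E']. apply eqv_le in R. apply R.
Qed.

Scheme typ_mind := Minimality for typ Sort Prop
with jtyp_mind := Minimality for jtyp Sort Prop.
Combined Scheme typ_jtyp_ind from typ_mind, jtyp_mind.

(** Total contexts need only be at least as generous as the partial ones: smaller types for
    variables, larger types for continuations. This makes the statement stable under [T_conv], with
    no condition on undeclared indices. *)
Lemma typ_den :
  (forall G D M T, typ G D M T -> forall g d, ctx_ext G g -> dctx_ext D d -> den g d M T) /\
  (forall G D J, jtyp G D J -> forall g d, ctx_ext G g -> dctx_ext D d -> denj g d J).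
Proof.
  apply typ_jtyp_ind; simpl.
  - intros. exists S; simpl; auto.
  - intros G D M ST _ IH g d Hg Hd. eexists; split; [left; reflexivity |].
    intros r Hr. apply in_map_iff in Hr. destruct Hr as (p & <- & Hp).
    exists (fst p), (snd p); split; auto. apply IH; auto using ctx_ext_cons.
  - intros G D M N T SS _ IHM _ IHN g d Hg Hd. eexists; split; [apply IHM; auto |].
    intros A HA. apply in_map_iff in HA. destruct HA as (Si & <- & HSi).
    exists Si; split; auto. intros U HU r [<- | []].
    exists (Arr U T); split; [| apply rle_refl]. apply in_map_iff; eauto.
  - intros G D L N T Ss _ IHL _ IHN g d Hg Hd. exists Ss; split; auto.
    intros s Hs. eapply IHL; eauto using ctx_ext_cons.
  - intros G D J T _ IH g d Hg Hd. apply IH; auto using dctx_ext_cons.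
  - intros G D M T T' _ IH L g d Hg Hd. apply le_tle in L.
    eapply den_weaken; [| | | apply IH]; eauto.
  - intros G G' D D' M M' T T' _ IH HG HD HM HT g d Hg Hd.
    apply (den_equiv _ _ HM). apply eqv_le in HT.
    eapply den_weaken; [| | apply HT | apply IH]; eauto using ctx_ext_eq, dctx_ext_eq.
  - intros G D k M T E _ IH g d Hg Hd.
    eapply den_weaken; [| | apply Hd, E | apply IH]; eauto.
  - intros G D J N Ss _ IHJ _ IHN g d Hg Hd. exists Ss; split; auto.
    intros s Hs. eapply IHJ; eauto using ctx_ext_cons.
  - intros G G' D D' J J' _ IH HG HD HJ g d Hg Hd.
    apply (denj_equiv _ _ HJ). eauto using ctx_ext_eq, dctx_ext_eq.
Qed.

(** * From the recursive typing back to derivations *)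

Fixpoint bnd_o (M : term) : nat :=
  match M with
  | Var x => S x
  | Lam M => pred (bnd_o M)
  | App M N => max (bnd_o M) (bnd_o N)
  | WhereT L N => max (pred (bnd_o L)) (bnd_o N)
  | Mu J => bnd_oj J
  end
with bnd_oj (J : jump) : nat :=
  match J with
  | Jmp _ M => bnd_o M
  | WhereJ J N => max (pred (bnd_oj J)) (bnd_o N)
  end.

Fixpoint bnd_c (M : term) : nat :=
  match M with
  | Var x => 0
  | Lam M => bnd_c M
  | App M N => max (bnd_c M) (bnd_c N)
  | WhereT L N => max (bnd_c L) (bnd_c N)
  | Mu J => pred (bnd_cj J)
  end
with bnd_cj (J : jump) : nat :=
  match J with
  | Jmp k M => max (S k) (bnd_c M)
  | WhereJ J N => max (bnd_cj J) (bnd_c N)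
  end.

(** A list context is finite, so it can agree with a total one only on the indices below a bound for
    the free variables. *)
Definition represents {A} (n : nat) (l : list (option A)) (f : nat -> A) : Prop :=
  forall x, x < n -> nth_error l x = Some (Some (f x)).

Lemma represents_cons {A} n l (f : nat -> A) a :
  represents (pred n) l f -> represents n (Some a :: l) (a .: f).
Proof. intros H [| x] Hx; simpl; auto. apply H. lia. Qed.

Lemma represents_le {A} n m l (f : nat -> A) :
  m <= n -> represents n l f -> represents m l f.
Proof. intros ? H x Hx; apply H; lia. Qed.

Lemma den_typ :
  (forall M G D g d T, represents (bnd_o M) G g -> represents (bnd_c M) D d ->
     den g d M T -> typ G D M T) /\
  (forall J G D g d, represents (bnd_oj J) G g -> represents (bnd_cj J) D d ->
     denj g d J -> jtyp G D J).
Proof.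
  assert (HL := @Nat.le_max_l). assert (HR := @Nat.le_max_r).
  apply term_jump_ind; simpl.
  - intros x G D g d T Hg Hd (s & Hs & L).
    eapply T_sub; [apply T_var, Hg; auto |]. apply tle_le.
    intros s' [<- | []]; eauto.
  - intros M IH G D g d T Hg Hd (s & Hs & L).
    assert (exists ST, s = map (fun p => Arr (fst p) (snd p)) ST /\
      forall p, In p ST -> typ (Some (fst p) :: G) D M (snd p)) as (ST & -> & HST).
    { clear Hs. induction s as [| r s IHs].
      - exists []; split; auto. intros p [].
      - destruct IHs as (ST & -> & HST). { intros; apply L; simpl; auto. }
        destruct (L r) as (S1 & T1 & -> & H1); [simpl; auto |].
        exists ((S1, T1) :: ST); split; auto. intros p [<- | Hp]; auto.
        eapply IH; [| | exact H1]; auto using represents_cons. }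
    eapply T_sub; [apply T_lam, HST |]. apply tle_le.
    intros s' [<- | []]; eauto.
  - intros M IHM N IHN G D g d T Hg Hd (As & H1 & H2).
    (* [T_app] asks for a union of intersections of arrows with the common result [T]. The members
       of [As] merely lie below such intersections, so [M] is moved to the exact shape by
       subsumption. *)
    assert (exists SS, tle As (map (fun Si => map (fun s => Arr s T) Si) SS) /\
      forall Si, In Si SS -> den g d N Si) as (SS & HSS & HN).
    { clear H1. induction As as [| A As IH].
      - exists []; split; [intros s [] | intros s []].
      - destruct IH as (SS & B1 & B2). { intros; apply H2; simpl; auto. }
        destruct (H2 A) as (Us & H3 & H4); [simpl; auto |].
        exists (Us :: SS); split.
        + intros s [<- | Hs]; simpl.
          * eexists; split; [left; reflexivity |]. intros r Hr.
            apply in_map_iff in Hr. destruct Hr as (U & <- & HU).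
            apply (H4 U HU). simpl; auto.
          * destruct (B1 s Hs) as (s' & ? & ?). eauto.
        + intros Si [<- | ?]; auto. }
    apply T_app with (SS := SS).
    + eapply IHM; [eapply represents_le; [| exact Hg] | eapply represents_le; [| exact Hd]
        | eapply den_weaken; [| | exact HSS | exact H1]]; auto.
    + intros Si HSi. eapply IHN; [eapply represents_le; [| exact Hg]
        | eapply represents_le; [| exact Hd] | apply HN]; auto.
  - intros L IHL N IHN G D g d T Hg Hd (Ss & H1 & H2).
    apply T_where with (Ss := Ss).
    + intros s Hs. eapply IHL; [| | apply H2, Hs].
      * apply represents_cons. eapply represents_le; [| exact Hg]; auto.
      * eapply represents_le; [| exact Hd]; auto.
    + eapply IHN; [eapply represents_le; [| exact Hg]
        | eapply represents_le; [| exact Hd] | exact H1]; auto.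
  - intros J IH G D g d T Hg Hd H. apply T_mu. eapply IH; [| | exact H]; auto.
    apply represents_cons; auto.
  - intros k M IH G D g d Hg Hd H. 
    eapply J_jmp; [apply Hd, (Nat.le_max_l (S k)) |].
    eapply IH; [exact Hg | eapply represents_le; [| exact Hd] | exact H].
    apply (Nat.le_max_r (S k)).
  - intros J IHJ N IHN G D g d Hg Hd (Ss & H1 & H2).
    apply J_where with (Ss := Ss).
    + intros s Hs. eapply IHJ; [| | apply H2, Hs].
      * apply represents_cons. eapply represents_le; [| exact Hg]; auto.
      * eapply represents_le; [| exact Hd]; auto.
    + eapply IHN; [eapply represents_le; [| exact Hg]
        | eapply represents_le; [| exact Hd] | exact H1]; auto.
Qed.

(** * Total contexts and types free of omega and mho *)

Definition sgood (s : sub) : Prop := sub_bad s = false.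
Definition tgood (T : ty) : Prop := ty_bad T = false.

(** Undeclared indices receive an atom, so that filling the gaps introduces neither omega nor
    mho. *)
Definition ctx_fun (G : ctx) (x : nat) : sub :=
  match nth_error G x with Some (Some s) => s | _ => [Atom 0] end.
Definition dctx_fun (D : dctx) (k : nat) : ty :=
  match nth_error D k with Some (Some T) => T | _ => [[Atom 0]] end.

Lemma typable_den G D M T : typ G D M T -> den (ctx_fun G) (dctx_fun D) M T.
Proof.
  intros H. eapply typ_den; [exact H | |]; intros x s E;
    unfold ctx_fun, dctx_fun; rewrite E; auto.
Qed.

Lemma ctx_fun_good G : ctx_ok G -> forall x, sgood (ctx_fun G x).
Proof.
  intros H x. unfold ctx_fun. destruct (nth_error G x) as [[s |] |] eqn:E; try reflexivity.
  exact (H _ _ E).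
Qed.

Lemma dctx_fun_good D : dctx_ok D -> forall x, tgood (dctx_fun D x).
Proof.
  intros H x. unfold dctx_fun. destruct (nth_error D x) as [[s |] |] eqn:E; try reflexivity.
  exact (H _ _ E).
Qed.

Definition tabulate {A} (f : nat -> A) (n : nat) : list (option A) :=
  map (fun x => Some (f x)) (seq 0 n).

Lemma nth_error_tabulate {A} (f : nat -> A) n x a :
  nth_error (tabulate f n) x = Some a -> a = Some (f x).
Proof.
  unfold tabulate. rewrite nth_error_map. intros E.
  destruct (nth_error (seq 0 n) x) as [y|] eqn:E'; simpl in E; [| discriminate].
  apply nth_error_nth with (d := 0) in E' as E2.
  assert (x < n). { rewrite <- (length_seq n 0). apply nth_error_Some. congruence. }
  rewrite seq_nth in E2 by auto. simpl in E2. congruence.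
Qed.

Lemma den_typable g d M T : den g d M T ->
  typ (tabulate g (bnd_o M)) (tabulate d (bnd_c M)) M T.
Proof.
  intros H. eapply den_typ; [| | exact H]; intros x Hx; unfold tabulate;
    rewrite nth_error_map, nth_error_nth' with (d := 0) by (rewrite length_seq; auto);
    rewrite seq_nth by auto; reflexivity.
Qed.

(** * Subject expansion *)

(** A value does not need a proper union: its clause in [den] already selects one member. Together
    with [value_den_inter] this is what call-by-value expansion rests on. *)
Lemma value_den_prime G D V T : is_value V = true -> den G D V T ->
  exists s, In s T /\ den G D V [s].
Proof.
  destruct V; simpl; try discriminate; intros _ (s & Hs & L);
    exists s; split; auto; exists s; simpl; auto.
Qed.

Lemma value_den_inter G D V s : is_value V = true ->
  (forall r, In r s -> den G D V [[r]]) -> den G D V [s].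
Proof.
  destruct V; simpl; try discriminate; intros _ H; exists s; split; auto.
  - intros r Hr. destruct (H r Hr) as (s' & [<- | []] & L). apply L; simpl; auto.
  - intros r Hr. destruct (H r Hr) as (s' & [<- | []] & L). apply L; simpl; auto.
Qed.

Lemma den_sle G D V s s' : sle s s' -> den G D V [s] -> den G D V [s'].
Proof.
  intros L. apply den_weaken; auto. intros x [<- | []]. exists s'; simpl; auto.
Qed.

Lemma value_den_app G D V s s' : is_value V = true ->
  den G D V [s] -> den G D V [s'] -> den G D V [s ++ s'].
Proof.
  intros HV H1 H2. apply value_den_inter; auto. intros r Hr.
  apply in_app_or in Hr. destruct Hr;
    [apply (den_sle _ _ _ s) | apply (den_sle _ _ _ s')]; auto;
    apply sle_incl; intros x [<- | []]; auto.
Qed.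

Definition sub_den (G : nat -> sub) (D : nat -> ty) (theta : nat -> term)
  (G' : nat -> sub) : Prop := forall x, den G D (theta x) [G' x].

Lemma sub_den_app G D theta G1 G2 : (forall x, is_value (theta x) = true) ->
  sub_den G D theta G1 -> sub_den G D theta G2 ->
  sub_den G D theta (fun x => G1 x ++ G2 x).
Proof. intros HV H1 H2 x. apply value_den_app; auto. Qed.

Lemma gle_app_l (G1 G2 : nat -> sub) : gle (fun x => G1 x ++ G2 x) G1.
Proof. intros x. apply sle_incl, incl_appl, incl_refl. Qed.

Lemma gle_app_r (G1 G2 : nat -> sub) : gle (fun x => G1 x ++ G2 x) G2.
Proof. intros x. apply sle_incl, incl_appr, incl_refl. Qed.

Lemma sub_den_merge {A} (l : list A) G D theta (P : (nat -> sub) -> A -> Prop) :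
  (forall x, is_value (theta x) = true) ->
  (forall G1 G2 a, gle G2 G1 -> P G1 a -> P G2 a) ->
  (forall a, In a l -> exists G', sub_den G D theta G' /\ P G' a) ->
  exists G', sub_den G D theta G' /\ forall a, In a l -> P G' a.
Proof.
  intros HV HP. induction l as [| a l IH]; intros H.
  - exists (fun _ => []). split; [| intros a []].
    intros x. apply value_den_inter; auto. intros r [].
  - destruct IH as (G1 & A1 & B1). { intros; apply H; simpl; auto. }
    destruct (H a) as (G2 & A2 & B2); [simpl; auto |].
    exists (fun x => G1 x ++ G2 x). split; [apply sub_den_app; auto |].
    intros b [<- | Hb]; [apply (HP G2) | apply (HP G1)]; auto using gle_app_l, gle_app_r.
Qed.

Lemma is_value_ren_o xi M : is_value (ren_o xi M) = is_value M.
Proof. destruct M; reflexivity. Qed.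

Lemma is_value_ren_c xi M : is_value (ren_c xi M) = is_value M.
Proof. destruct M; reflexivity. Qed.

Lemma is_value_up_o theta : (forall x, is_value (theta x) = true) ->
  forall x, is_value (up_o theta x) = true.
Proof. intros H [| x]; simpl; auto. rewrite is_value_ren_o; auto. Qed.

Lemma is_value_up_c theta : (forall x, is_value (theta x) = true) ->
  forall x, is_value (up_c theta x) = true.
Proof. intros H x; unfold up_c. rewrite is_value_ren_c; auto. Qed.

Lemma sub_den_up_o s G D theta G' : sub_den (s .: G) D (up_o theta) G' ->
  sub_den G D theta (fun x => G' (S x)) /\ gle (s .: (fun x => G' (S x))) G'.
Proof.
  intros H. split.
  - intros x. apply (den_shift_o (theta x) s). apply (H (S x)).
  - intros [| x]; simpl; auto. destruct (H 0) as (s' & [<- | []] & L). exact L.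
Qed.

(** The types at which the occurrences of [theta x] are used are intersected to give the type of
    [x]. Values are essential: each occurrence uses one member of a union, and separate typings of a
    value combine into an intersection. *)
Lemma den_subst_o_inv :
  (forall M G D T theta, (forall x, is_value (theta x) = true) ->
     den G D (subst_o theta M) T ->
     exists G', sub_den G D theta G' /\ den G' D M T) /\
  (forall J G D theta, (forall x, is_value (theta x) = true) ->
     denj G D (subst_oj theta J) ->
     exists G', sub_den G D theta G' /\ denj G' D J).
Proof.
  apply term_jump_ind; simpl.
  - intros x G D T theta HV H. apply value_den_prime in H; auto.
    destruct H as (s & Hs & H).
    (* Variables other than [x] get omega, which every value has. *)
    exists (fun y => if y =? x then s else []). split.
    + intros y. destruct (Nat.eqb_spec y x) as [-> |]; auto.
      apply value_den_inter; auto. intros r [].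
    + exists s. rewrite Nat.eqb_refl. auto.
  - intros M IH G D T theta HV (s & Hs & L).
    destruct (sub_den_merge s G D theta
      (fun G' r => exists S1 T1, r = Arr S1 T1 /\ den (S1 .: G') D M T1)) as (G' & A & B);
      auto.
    + intros G1 G2 r HG (S1 & T1 & ? & ?). exists S1, T1; split; auto.
      eapply den_weaken; [| | | eassumption]; auto.
    + intros r Hr. destruct (L r Hr) as (S1 & T1 & -> & H).
      apply IH in H; auto using is_value_up_o. destruct H as (G' & H1 & H2).
      apply sub_den_up_o in H1. destruct H1 as (H1 & H3).
      eexists; split; [exact H1 |]. exists S1, T1; split; auto.
      eapply den_weaken; [| | | eassumption]; auto.
    + exists G'; split; auto. exists s; split; auto.
  - intros M IHM N IHN G D T theta HV (As & H1 & H2).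
    apply IHM in H1; auto. destruct H1 as (G1 & A1 & B1).
    destruct (sub_den_merge As G D theta (fun G' A => exists Us, den G' D N Us /\
      forall U, In U Us -> sle A [Arr U T])) as (G2 & A2 & B2); auto.
    + intros G2 G3 A HG (Us & ? & ?). exists Us; split; auto.
      eapply den_weaken; [| | | eassumption]; auto.
    + intros A HA. destruct (H2 A HA) as (Us & H3 & H4).
      apply IHN in H3; auto. destruct H3 as (G' & ? & ?). eauto.
    + exists (fun x => G1 x ++ G2 x). split; [apply sub_den_app; auto |].
      exists As; split.
      * eapply den_weaken; [apply gle_app_l | | | exact B1]; auto.
      * intros A HA. destruct (B2 A HA) as (Us & ? & ?). exists Us; split; auto.
        eapply den_weaken; [apply gle_app_r | | | eassumption]; auto.
  - intros L IHL N IHN G D T theta HV (Ss & H1 & H2).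
    apply IHN in H1; auto. destruct H1 as (G1 & A1 & B1).
    destruct (sub_den_merge Ss G D theta (fun G' s => den (s .: G') D L T))
      as (G2 & A2 & B2); auto.
    + intros G2 G3 s HG. apply den_weaken; auto.
    + intros s Hs. apply H2, IHL in Hs; auto using is_value_up_o.
      destruct Hs as (G' & H3 & H4).
      apply sub_den_up_o in H3. destruct H3 as (H3 & H5).
      eexists; split; [exact H3 |].
      eapply den_weaken; [| | | eassumption]; auto.
    + exists (fun x => G1 x ++ G2 x). split; [apply sub_den_app; auto |].
      exists Ss; split.
      * eapply den_weaken; [apply gle_app_l | | | exact B1]; auto.
      * intros s Hs. eapply den_weaken; [| | | apply B2, Hs]; auto using gle_app_r.
  - intros J IH G D T theta HV H. apply IH in H; auto using is_value_up_c.
    destruct H as (G' & H1 & H2). exists G'; split; auto.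
    intros x. apply (den_shift_c (theta x) T), H1.
  - intros k M IH G D theta HV H. apply IH; auto.
  - intros J IHJ N IHN G D theta HV (Ss & H1 & H2).
    apply IHN in H1; auto. destruct H1 as (G1 & A1 & B1).
    destruct (sub_den_merge Ss G D theta (fun G' s => denj (s .: G') D J))
      as (G2 & A2 & B2); auto.
    + intros G2 G3 s HG. apply denj_weaken; auto.
    + intros s Hs. apply H2, IHJ in Hs; auto using is_value_up_o.
      destruct Hs as (G' & H3 & H4).
      apply sub_den_up_o in H3. destruct H3 as (H3 & H5).
      eexists; split; [exact H3 |].
      eapply denj_weaken; [| | eassumption]; auto.
    + exists (fun x => G1 x ++ G2 x). split; [apply sub_den_app; auto |].
      exists Ss; split.
      * eapply den_weaken; [apply gle_app_l | | | exact B1]; auto.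
      * intros s Hs. eapply denj_weaken; [| | apply B2, Hs]; auto using gle_app_r.
Qed.

(** * Inverting the context substitution *)

Definition upd {A} (k : nat) (a : A) (f : nat -> A) (n : nat) : A :=
  if n =? k then a else f n.

Lemma upd_scons {A} k (a b : A) f : upd (S k) a (b .: f) = b .: upd k a f.
Proof. extensionality n. destruct n; reflexivity. Qed.

Lemma dle_upd k U U' D : tle U U' -> dle (upd k U D) (upd k U' D).
Proof. intros H n. unfold upd. destruct (n =? k); auto. Qed.

Lemma tle_app_l (T1 T2 : ty) : tle T1 (T1 ++ T2).
Proof. apply tle_incl, incl_appl, incl_refl. Qed.

Lemma tle_app_r (T1 T2 : ty) : tle T2 (T1 ++ T2).
Proof. apply tle_incl, incl_appr, incl_refl. Qed.

(** Says that the frame binding its hole in [P] turns an argument of the union type [U] into a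
    result of type [T]. *)
Definition frame_den (G : nat -> sub) (D : nat -> ty) (P : term) (T U : ty) : Prop :=
  forall s, In s U -> den (s .: G) D P T.

Lemma frame_den_app G D P T U1 U2 :
  frame_den G D P T U1 -> frame_den G D P T U2 -> frame_den G D P T (U1 ++ U2).
Proof. intros H1 H2 s Hs. apply in_app_or in Hs. destruct Hs; auto. Qed.

Lemma frame_den_merge {A} (l : list A) G D P T (Q : ty -> A -> Prop) :
  (forall U1 U2 a, tle U1 U2 -> Q U1 a -> Q U2 a) ->
  (forall a, In a l -> exists U, frame_den G D P T U /\ Q U a) ->
  exists U, frame_den G D P T U /\ forall a, In a l -> Q U a.
Proof.
  intros HQ H. destruct (merge_ty l Q (fun s _ => den (s .: G) D P T)) as (U & A1 & A2); auto.
  - intros a Ha. destruct (H a Ha) as (U & ? & ?). eauto.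
  - exists U; split; auto. intros s Hs. destruct (A2 s Hs) as (_ & _ & ?). auto.
Qed.

Lemma frame_den_shift_o s G D P T U :
  frame_den (s .: G) D (ren_o (upren S) P) T U -> frame_den G D P T U.
Proof. intros H s' Hs'. apply (den_shift_o1 P s' s). auto. Qed.

Lemma den_cs_inv :
  (forall M G D T k P, den G D (cs_t k P M) T ->
     exists U, frame_den G D P (D k) U /\ den G (upd k U D) M T) /\
  (forall J G D k P, denj G D (cs_j k P J) ->
     exists U, frame_den G D P (D k) U /\ denj G (upd k U D) J).
Proof.
  apply term_jump_ind; simpl.
  - intros x G D T k P H. exists []; split; auto. intros s [].
  - intros M IH G D T k P (s & Hs & L).
    destruct (frame_den_merge s G D P (D k)
      (fun U r => exists S1 T1, r = Arr S1 T1 /\ den (S1 .: G) (upd k U D) M T1))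
      as (U & A & B).
    + intros U1 U2 r HU (S1 & T1 & ? & ?). exists S1, T1; split; auto.
      eapply den_weaken; [| | | eassumption]; auto using dle_upd.
    + intros r Hr. destruct (L r Hr) as (S1 & T1 & -> & H).
      apply IH in H. destruct H as (U & H1 & H2). apply frame_den_shift_o in H1.
      exists U; split; auto. exists S1, T1; auto.
    + exists U; split; auto. exists s; auto.
  - intros M IHM N IHN G D T k P (As & H1 & H2).
    apply IHM in H1. destruct H1 as (U1 & A1 & B1).
    destruct (frame_den_merge As G D P (D k) (fun U A => exists Us, den G (upd k U D) N Us /\
      forall V, In V Us -> sle A [Arr V T])) as (U2 & A2 & B2).
    + intros U2 U3 A HU (Us & ? & ?). exists Us; split; auto.
      eapply den_weaken; [| | | eassumption]; auto using dle_upd.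
    + intros A HA. destruct (H2 A HA) as (Us & H3 & H4).
      apply IHN in H3. destruct H3 as (U & ? & ?). eauto.
    + exists (U1 ++ U2). split; [apply frame_den_app; auto |].
      exists As; split.
      * eapply den_weaken; [| | | exact B1]; auto using dle_upd, tle_app_l.
      * intros A HA. destruct (B2 A HA) as (Us & ? & ?). exists Us; split; auto.
        eapply den_weaken; [| | | eassumption]; auto using dle_upd, tle_app_r.
  - intros L IHL N IHN G D T k P (Ss & H1 & H2).
    apply IHN in H1. destruct H1 as (U1 & A1 & B1).
    destruct (frame_den_merge Ss G D P (D k) (fun U s => den (s .: G) (upd k U D) L T))
      as (U2 & A2 & B2).
    + intros U2 U3 s HU. apply den_weaken; auto using dle_upd.
    + intros s Hs. apply H2, IHL in Hs. destruct Hs as (U & H3 & H4).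
      apply frame_den_shift_o in H3. eauto.
    + exists (U1 ++ U2). split; [apply frame_den_app; auto |].
      exists Ss; split.
      * eapply den_weaken; [| | | exact B1]; auto using dle_upd, tle_app_l.
      * intros s Hs. eapply den_weaken; [| | | apply B2, Hs]; auto using dle_upd, tle_app_r.
  - intros J IH G D T k P H. apply IH in H. destruct H as (U & H1 & H2).
    rewrite upd_scons in H2. exists U; split; auto.
    intros s Hs. apply (den_shift_c P T). apply H1; auto.
  - intros l Q IH G D k P H. destruct (Nat.eqb_spec l k) as [-> | Hlk].
    + destruct H as (Ss & H1 & H2). apply IH in H1. destruct H1 as (U & A & B).
      (* [Ss] comes from this jump, [U] from the jumps to [k] nested inside [Q]. *)
      exists (U ++ Ss). split; [apply frame_den_app; auto |]. simpl.
      unfold upd at 2. rewrite Nat.eqb_refl.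
      eapply den_weaken; [| | | exact B]; auto using dle_upd, tle_app_l, tle_app_r.
    + apply IH in H. destruct H as (U & A & B). exists U; split; auto.
      simpl. unfold upd at 2. apply Nat.eqb_neq in Hlk. rewrite Hlk. exact B.
  - intros J IHJ N IHN G D k P (Ss & H1 & H2).
    apply IHN in H1. destruct H1 as (U1 & A1 & B1).
    destruct (frame_den_merge Ss G D P (D k) (fun U s => denj (s .: G) (upd k U D) J))
      as (U2 & A2 & B2).
    + intros U2 U3 s HU. apply denj_weaken; auto using dle_upd.
    + intros s Hs. apply H2, IHJ in Hs. destruct Hs as (U & H3 & H4).
      apply frame_den_shift_o in H3. eauto.
    + exists (U1 ++ U2). split; [apply frame_den_app; auto |].
      exists Ss; split.
      * eapply den_weaken; [| | | exact B1]; auto using dle_upd, tle_app_l.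
      * intros s Hs. eapply denj_weaken; [| | apply B2, Hs]; auto using dle_upd, tle_app_r.
Qed.

(* Expansion along [R_eta] fails at an atomic type: [V] may have type [Atom a],
   but an abstraction only has arrow types.  Replacing every atom [a] of a
   derivation by [a -> a] removes the obstruction. *)
Fixpoint asub (r : raw) : raw :=
  match r with
  | Atom a => Arr [Atom a] [[Atom a]]
  | Arr s T => Arr (map asub s) (map (map asub) T)
  end.

Lemma rle_asub b : forall a,
  (rle a b -> rle (asub a) (asub b)) /\ (rle b a -> rle (asub b) (asub a)).
Proof.
  induction b as [n | s T IHS IHT] using raw_nested_ind; intros a; split; intros H;
    inversion H as [| S1 S2 T1 T2 A B]; subst; simpl; auto using rle_refl.
  - constructor.
    + intros r Hr. apply in_map_iff in Hr. destruct Hr as (r0 & <- & Hr0).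
      destruct (A r0 Hr0) as (r' & ? & ?). exists (asub r'); split; auto using in_map.
      apply (proj2 (IHS r' H0 r0)); auto.
    + intros u Hu. apply in_map_iff in Hu. destruct Hu as (u0 & <- & Hu0).
      destruct (B u0 Hu0) as (u' & Hu' & L). exists (map asub u'); split; auto using in_map.
      intros r Hr. apply in_map_iff in Hr. destruct Hr as (r0 & <- & Hr0).
      destruct (L r0 Hr0) as (r' & ? & ?). exists (asub r'); split; auto using in_map.
      apply (proj1 (IHT u' Hu' r0 Hr0 r')); auto.
  - constructor.
    + intros r Hr. apply in_map_iff in Hr. destruct Hr as (r0 & <- & Hr0).
      destruct (A r0 Hr0) as (r' & ? & ?). exists (asub r'); split; auto using in_map.
      apply (proj1 (IHS r0 Hr0 r')); auto.
    + intros u Hu. apply in_map_iff in Hu. destruct Hu as (u0 & <- & Hu0).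
      destruct (B u0 Hu0) as (u' & Hu' & L). exists (map asub u'); split; auto using in_map.
      intros r Hr. apply in_map_iff in Hr. destruct Hr as (r0 & <- & Hr0).
      destruct (L r0 Hr0) as (r' & ? & ?). exists (asub r'); split; auto using in_map.
      apply (proj2 (IHT u0 Hu0 r' H0 r0)); auto.
Qed.

Lemma sle_asub s s' : sle s s' -> sle (map asub s) (map asub s').
Proof.
  intros L r Hr. apply in_map_iff in Hr. destruct Hr as (r0 & <- & Hr0).
  destruct (L r0 Hr0) as (r' & ? & ?). exists (asub r'); split; auto using in_map.
  apply (proj1 (rle_asub r0 r')); auto.
Qed.

Definition gsub (G : nat -> sub) (x : nat) : sub := map asub (G x).
Definition dsub (D : nat -> ty) (k : nat) : ty := map (map asub) (D k).

Lemma gsub_scons s G : gsub (s .: G) = map asub s .: gsub G.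
Proof. extensionality n. destruct n; reflexivity. Qed.

Lemma dsub_scons T D : dsub (T .: D) = map (map asub) T .: dsub D.
Proof. extensionality n. destruct n; reflexivity. Qed.

Lemma den_asub :
  (forall M G D T, den G D M T -> den (gsub G) (dsub D) M (map (map asub) T)) /\
  (forall J G D, denj G D J -> denj (gsub G) (dsub D) J).
Proof.
  apply term_jump_ind; simpl.
  - intros x G D T (s & Hs & L). exists (map asub s); split; auto using in_map, sle_asub.
    apply sle_asub, L.
  - intros M IH G D T (s & Hs & L). exists (map asub s); split; auto using in_map.
    intros r Hr. apply in_map_iff in Hr. destruct Hr as (r0 & <- & Hr0).
    destruct (L r0 Hr0) as (S1 & T1 & -> & H). do 2 eexists; split; [reflexivity |].
    apply IH in H. rewrite gsub_scons in H. exact H.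
  - intros M IHM N IHN G D T (As & H1 & H2). exists (map (map asub) As); split; auto.
    intros A HA. apply in_map_iff in HA. destruct HA as (A0 & <- & HA0).
    destruct (H2 A0 HA0) as (Us & H3 & H4). exists (map (map asub) Us); split; auto.
    intros U HU. apply in_map_iff in HU. destruct HU as (U0 & <- & HU0).
    apply (sle_asub _ _ (H4 U0 HU0)).
  - intros L IHL N IHN G D T (Ss & H1 & H2). exists (map (map asub) Ss); split; auto.
    intros s Hs. apply in_map_iff in Hs. destruct Hs as (s0 & <- & Hs0).
    rewrite <- gsub_scons. auto.
  - intros J IH G D T H. rewrite <- dsub_scons. auto.
  - intros k M IH G D H. apply IH, H.
  - intros J IHJ N IHN G D (Ss & H1 & H2). exists (map (map asub) Ss); split; auto.
    intros s Hs. apply in_map_iff in Hs. destruct Hs as (s0 & <- & Hs0).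
    rewrite <- gsub_scons. auto.
Qed.

Lemma den_eta_expand G D V T : is_value V = true -> den G D V T ->
  den (gsub G) (dsub D) (Lam (App (ren_o S V) (Var 0))) (map (map asub) T).
Proof.
  intros HV H. apply (proj1 den_asub) in H. apply value_den_prime in H; auto.
  destruct H as (s & Hs & H). exists s; split; auto. intros r Hr.
  apply in_map_iff in Hs. destruct Hs as (s0 & <- & _).
  (* Every raw type in the image of [asub] is an arrow, even when it comes from an atom. *)
  assert (exists S1 T1, r = Arr S1 T1) as (S1 & T1 & ->).
  { apply in_map_iff in Hr. destruct Hr as ([a | S1 T1] & <- & _); simpl; eauto. }
  exists S1, T1; split; auto. exists [map asub s0]; split; [apply den_shift_o; auto |].
  intros A [<- | []]. exists [S1]; split.
  - exists S1; simpl; auto.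
  - intros U [<- | []]. apply sle_incl. intros r [<- | []]; auto.
Qed.

(** * Expansion along the reduction rules *)

Lemma den_where_val_expand G D M V T : is_value V = true ->
  den G D (subst_o (subst1 V) M) T -> den G D (WhereT M V) T.
Proof.
  intros HV H. apply (proj1 den_subst_o_inv) in H.
  2:{ intros [| x]; simpl; auto. }
  destruct H as (G' & H1 & H2). exists [G' 0]; split; [apply (H1 0) |].
  intros s [<- | []]. eapply den_weaken; [| | | exact H2]; auto.
  intros [| x]; simpl; auto. destruct (H1 (S x)) as (s & [<- | []] & L). exact L.
Qed.

Lemma upd0 {A} (a b : A) f : upd 0 a (b .: f) = a .: f.
Proof. extensionality n. destruct n; reflexivity. Qed.

Lemma den_where_mu_expand G D M J T :
  den G D (Mu (cs_j 0 (ren_c S M) J)) T -> den G D (WhereT M (Mu J)) T.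
Proof.
  simpl. intros H. apply (proj2 den_cs_inv) in H. destruct H as (U & H1 & H2).
  rewrite upd0 in H2. exists U; split; auto.
  intros s Hs. apply (den_shift_c M T). apply H1; auto.
Qed.

Lemma den_app_l_expand G D N M T :
  den G D (WhereT (App (Var 0) (ren_o S M)) N) T -> den G D (App N M) T.
Proof.
  intros (Ss & H1 & H2). exists Ss; split; auto. intros s Hs.
  destruct (H2 s Hs) as (As & (A & HA & L) & H3).
  destruct (H3 A HA) as (Us & H4 & H5). exists Us; split.
  - apply den_shift_o in H4; auto.
  - intros U HU. eapply sle_trans; [exact L | apply (H5 U HU)].
Qed.

Lemma den_app_r_expand G D V N T : is_value V = true ->
  den G D (WhereT (App (ren_o S V) (Var 0)) N) T -> den G D (App V N) T.
Proof.
  (* [V] must serve every argument type in [Ss] with one typing. Being a value, it takes the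
     intersection of the corresponding arrows. *)
  intros HV (Ss & H1 & H2). exists [map (fun s => Arr s T) Ss]; split.
  - apply value_den_inter; auto. intros r Hr. apply in_map_iff in Hr.
    destruct Hr as (s & <- & Hs). destruct (H2 s Hs) as (As & H3 & H4).
    apply den_shift_o, value_den_prime in H3; auto. destruct H3 as (A & HA & H3).
    destruct (H4 A HA) as (Us & (U & HU & L) & H5).
    eapply den_sle; [| exact H3]. eapply sle_trans; [apply (H5 U HU) |].
    intros r [<- | []]. eexists; split; [left; reflexivity |]. apply rle_Arr; auto.
  - intros A [<- | []]. exists Ss; split; auto. intros U HU. apply sle_incl.
    intros r [<- | []]. apply in_map_iff; eauto.
Qed.

Lemma den_beta_expand G D M V T : is_value V = true ->
  den G D (WhereT M V) T -> den G D (App (Lam M) V) T.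
Proof.
  intros HV (Ss & H1 & H2). apply value_den_prime in H1; auto.
  destruct H1 as (s & Hs & H1). exists [[Arr s T]]; split.
  - exists [Arr s T]; simpl; split; auto. intros r [<- | []]. exists s, T; auto.
  - intros A [<- | []]. exists [s]; split; auto. intros U [<- | []]. auto.
Qed.

Lemma csub1_scons {A} (D : nat -> A) l : (fun x => D (csub1 l x)) = D l .: D.
Proof. extensionality n. destruct n; reflexivity. Qed.

Scheme step_t_mind := Minimality for step_t Sort Prop
with step_j_mind := Minimality for step_j Sort Prop.
Combined Scheme step_ind from step_t_mind, step_j_mind.

(** Most root steps expand at the same type and are then pushed through [asub]; [R_eta] genuinely
    uses the replacement. It is applied to contexts and type alike so that the cases under binders
    and in contexts go through. *)
Lemma den_expand :
  (forall M M', step_t M M' -> forall G D T, den G D M' T ->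
     den (gsub G) (dsub D) M (map (map asub) T)) /\
  (forall J J', step_j J J' -> forall G D, denj G D J' -> denj (gsub G) (dsub D) J).
Proof.
  destruct den_asub as [AT AJ].
  apply step_ind.
  - intros. apply AT, den_app_l_expand; auto.
  - intros. apply AT, den_app_r_expand; auto.
  - intros. apply AT, den_beta_expand; auto.
  - intros. apply AT, den_where_val_expand; auto.
  - intros. apply AT, den_where_mu_expand; auto.
  - intros. apply den_eta_expand; auto.
  - intros M G D T H. apply AT. exists T; split; auto. intros s Hs. exists s; auto.
  - intros M G D T H. apply AT. simpl. apply den_shift_c. auto.
  - intros M M' _ IH G D T (s & Hs & L). exists (map asub s); split; auto using in_map.
    intros r Hr. apply in_map_iff in Hr. destruct Hr as (r0 & <- & Hr0).
    destruct (L r0 Hr0) as (S1 & T1 & -> & H). do 2 eexists; split; [reflexivity |].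
    apply IH in H. rewrite gsub_scons in H. exact H.
  - intros M M' N _ IH G D T (As & H1 & H2). exists (map (map asub) As); split; auto.
    intros A HA. apply in_map_iff in HA. destruct HA as (A0 & <- & HA0).
    destruct (H2 A0 HA0) as (Us & H3 & H4). exists (map (map asub) Us); split; auto.
    intros U HU. apply in_map_iff in HU. destruct HU as (U0 & <- & HU0).
    apply (sle_asub _ _ (H4 U0 HU0)).
  - intros M N N' _ IH G D T (As & H1 & H2). exists (map (map asub) As); split; auto.
    intros A HA. apply in_map_iff in HA. destruct HA as (A0 & <- & HA0).
    destruct (H2 A0 HA0) as (Us & H3 & H4). exists (map (map asub) Us); split; auto.
    intros U HU. apply in_map_iff in HU. destruct HU as (U0 & <- & HU0).
    apply (sle_asub _ _ (H4 U0 HU0)).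
  - intros L L' N _ IH G D T (Ss & H1 & H2). exists (map (map asub) Ss); split; auto.
    intros s Hs. apply in_map_iff in Hs. destruct Hs as (s0 & <- & Hs0).
    rewrite <- gsub_scons. auto.
  - intros L N N' _ IH G D T (Ss & H1 & H2). exists (map (map asub) Ss); split; auto.
    intros s Hs. apply in_map_iff in Hs. destruct Hs as (s0 & <- & Hs0).
    rewrite <- gsub_scons. auto.
  - intros J J' _ IH G D T H. simpl. rewrite <- dsub_scons. auto.
  - intros l J G D H. apply AJ. simpl. rewrite <- csub1_scons.
    apply (proj2 den_ren_c J (csub1 l)), H.
  - intros k M M' _ IH G D H. apply IH, H.
  - intros J J' N _ IH G D (Ss & H1 & H2). exists (map (map asub) Ss); split; auto.
    intros s Hs. apply in_map_iff in Hs. destruct Hs as (s0 & <- & Hs0).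
    rewrite <- gsub_scons. auto.
  - intros J N N' _ IH G D (Ss & H1 & H2). exists (map (map asub) Ss); split; auto.
    intros s Hs. apply in_map_iff in Hs. destruct Hs as (s0 & <- & Hs0).
    rewrite <- gsub_scons. auto.
Qed.

(** * Preservation of good types *)

Lemma sgood_iff s : sgood s <-> s <> [] /\ forall r, In r s -> raw_bad r = false.
Proof.
  unfold sgood, sub_bad. rewrite orb_false_iff. split.
  - intros [H1 H2]. split; [intros ->; discriminate |]. intros r Hr.
    destruct (raw_bad r) eqn:E; auto. rewrite <- H2. symmetry. apply existsb_exists; eauto.
  - intros [H1 H2]. split; [destruct s; auto; congruence |].
    destruct (existsb raw_bad s) eqn:E; auto. apply existsb_exists in E.
    destruct E as (r & Hr & E). rewrite H2 in E; auto.
Qed.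

Lemma tgood_iff T : tgood T <-> T <> [] /\ forall s, In s T -> sgood s.
Proof.
  unfold tgood, ty_bad. rewrite orb_false_iff. split.
  - intros [H1 H2]. split; [intros ->; discriminate |]. intros r Hr. red.
    destruct (sub_bad r) eqn:E; auto. rewrite <- H2. symmetry. apply existsb_exists; eauto.
  - intros [H1 H2]. split; [destruct T; auto; congruence |].
    destruct (existsb sub_bad T) eqn:E; auto. apply existsb_exists in E.
    destruct E as (r & Hr & E). rewrite H2 in E; auto.
Qed.

Lemma raw_bad_Arr s T : raw_bad (Arr s T) = false <-> sgood s /\ tgood T.
Proof.
  change (raw_bad (Arr s T)) with
    (nilb s || existsb raw_bad s || nilb T || existsb sub_bad T).
  unfold sgood, tgood, sub_bad, ty_bad. rewrite !orb_false_iff. tauto.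
Qed.

Lemma raw_bad_asub r : raw_bad r = false -> raw_bad (asub r) = false.
Proof.
  induction r as [a | s T IHS IHT] using raw_nested_ind; intros H; [reflexivity |].
  apply raw_bad_Arr in H. destruct H as [H1 H2]. simpl asub. apply raw_bad_Arr.
  rewrite sgood_iff in *. rewrite tgood_iff in *. destruct H1 as [H1 H3], H2 as [H2 H4].
  split; split.
  - destruct s; simpl; congruence.
  - intros r Hr. apply in_map_iff in Hr. destruct Hr as (r0 & <- & Hr0). auto.
  - destruct T; simpl; congruence.
  - intros u Hu. apply in_map_iff in Hu. destruct Hu as (u0 & <- & Hu0).
    specialize (H4 u0 Hu0). rewrite sgood_iff in *. destruct H4 as [H4 H5]. split.
    + destruct u0; simpl; congruence.
    + intros r Hr. apply in_map_iff in Hr. destruct Hr as (r0 & <- & Hr0). eauto.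
Qed.

Lemma sgood_asub s : sgood s -> sgood (map asub s).
Proof.
  rewrite !sgood_iff. intros [H1 H2]. split; [destruct s; simpl; congruence |].
  intros r Hr. apply in_map_iff in Hr. destruct Hr as (r0 & <- & Hr0).
  auto using raw_bad_asub.
Qed.

Lemma tgood_asub T : tgood T -> tgood (map (map asub) T).
Proof.
  rewrite !tgood_iff. intros [H1 H2]. split; [destruct T; simpl; congruence |].
  intros r Hr. apply in_map_iff in Hr. destruct Hr as (r0 & <- & Hr0).
  auto using sgood_asub.
Qed.

Definition typable (M : term) : Prop := exists G D T, den G D M T.
Definition good_typable (M : term) : Prop := exists G D T,
  den G D M T /\ (forall x, sgood (G x)) /\ (forall k, tgood (D k)) /\ tgood T.

Lemma typable_expand M M' : step_t M M' -> typable M' -> typable M.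
Proof.
  intros H (G & D & T & HT). do 3 eexists. eapply den_expand; eauto.
Qed.

Lemma good_typable_red1 M M' : red1 M M' -> good_typable M' -> good_typable M.
Proof.
  intros (N & N' & H1 & H2 & H3) (G & D & T & HT & HG & HD & HT').
  exists (gsub G), (dsub D), (map (map asub) T). repeat split.
  - apply (den_equiv _ _ H1). eapply den_expand; eauto. apply (den_equiv _ _ H2); auto.
  - intros x. apply sgood_asub, HG.
  - intros k. apply tgood_asub, HD.
  - apply tgood_asub, HT'.
Qed.

(** * Normal forms *)

Inductive kind := KVal | KApp | KMu.

Fixpoint tail (M : term) : kind :=
  match M with
  | Var _ | Lam _ => KVal
  | App _ _ => KApp
  | WhereT L _ => tail L
  | Mu _ => KMu
  end.

Definition is_var (M : term) : bool := match M with Var _ => true | _ => false end.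

(* Normality with respect to the rules other than the three eta rules.  Both
   side conditions on [tail] are invariant under (E1)-(E3), so that a normal
   term has no redex in any congruent presentation. *)
Fixpoint nf (M : term) : Prop :=
  match M with
  | Var _ => True
  | Lam M => nf M
  | App M N => is_var M = true /\ is_value N = true /\ nf N
  | WhereT L N => nf L /\ nf N /\ tail N = KApp
  | Mu J => nfj J
  end
with nfj (J : jump) : Prop :=
  match J with
  | Jmp _ M => nf M /\ tail M <> KMu
  | WhereJ J N => nfj J /\ nf N /\ tail N = KApp
  end.

Fixpoint size (M : term) : nat :=
  match M with
  | Var _ => 1
  | Lam M => S (size M)
  | App M N => S (size M + size N)
  | WhereT L N => S (size L + size N)
  | Mu J => S (sizej J)
  end
with sizej (J : jump) : nat :=
  match J with
  | Jmp _ M => S (size M)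
  | WhereJ J N => S (sizej J + size N)
  end.


Lemma tail_ren_o M : forall xi, tail (ren_o xi M) = tail M.
Proof. induction M; simpl; auto. Qed.

Lemma tail_ren_c M : forall xi, tail (ren_c xi M) = tail M.
Proof. induction M; simpl; auto. Qed.

Lemma is_var_ren_o M xi : is_var (ren_o xi M) = is_var M.
Proof. destruct M; reflexivity. Qed.

Lemma is_var_ren_c M xi : is_var (ren_c xi M) = is_var M.
Proof. destruct M; reflexivity. Qed.

Lemma size_ren_o : (forall M xi, size (ren_o xi M) = size M) /\
  (forall J xi, sizej (ren_oj xi J) = sizej J).
Proof. apply term_jump_ind; simpl; auto. Qed.

Lemma size_ren_c : (forall M xi, size (ren_c xi M) = size M) /\
  (forall J xi, sizej (ren_cj xi J) = sizej J).
Proof. apply term_jump_ind; simpl; auto. Qed.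

Lemma nf_ren_o : (forall M xi, nf (ren_o xi M) <-> nf M) /\
  (forall J xi, nfj (ren_oj xi J) <-> nfj J).
Proof.
  apply term_jump_ind; simpl; intros;
    rewrite ?is_var_ren_o, ?is_value_ren_o, ?tail_ren_o, ?H, ?H0; tauto.
Qed.

Lemma nf_ren_c : (forall M xi, nf (ren_c xi M) <-> nf M) /\
  (forall J xi, nfj (ren_cj xi J) <-> nfj J).
Proof.
  apply term_jump_ind; simpl; intros;
    rewrite ?is_var_ren_c, ?is_value_ren_c, ?tail_ren_c, ?H, ?H0; tauto.
Qed.

(** The congruence only rearranges constructors, and [size] weighs [WhereT] and [WhereJ] alike, so
    [size] is a measure on congruence classes. The other invariants feed the side conditions of [nf]
    during the induction. *)
Lemma nf_ceq1 :
  (forall M M', ceq1_t M M' -> (nf M <-> nf M') /\ tail M = tail M' /\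
     size M = size M' /\ is_value M = is_value M' /\ is_var M = is_var M') /\
  (forall J J', ceq1_j J J' -> (nfj J <-> nfj J') /\ sizej J = sizej J').
Proof.
  apply ceq1_ind; simpl; intros.
  - rewrite tail_ren_o, (proj1 size_ren_o), (proj1 nf_ren_o).
    repeat split; try tauto; lia.
  - rewrite tail_ren_c, (proj1 size_ren_c), (proj1 nf_ren_c).
    repeat split; try tauto; lia.
  - destruct H0 as (A & B & C & E & F). repeat split; try tauto; lia.
  - destruct H0 as (A & B & C & E & F). rewrite F, C. repeat split; tauto.
  - destruct H0 as (A & B & C & E & F). rewrite E, C. repeat split; tauto.
  - destruct H0 as (A & B & C & E & F). rewrite B, C. repeat split; tauto.
  - destruct H0 as (A & B & C & E & F). rewrite B, C. repeat split; tauto.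
  - destruct H0 as (A & B). rewrite B. repeat split; tauto.
  - rewrite (proj2 size_ren_o), (proj2 nf_ren_o).
    repeat split; try tauto; lia.
  - repeat split; tauto.
  - destruct H0 as (A & B & C & E & F). rewrite B, C. repeat split; tauto.
  - destruct H0 as (A & B). rewrite B. repeat split; tauto.
  - destruct H0 as (A & B & C & E & F). rewrite B, C. repeat split; tauto.
Qed.

Lemma nf_equiv M M' : tm_equiv M M' -> (nf M <-> nf M') /\ size M = size M'.
Proof.
  induction 1.
  - apply nf_ceq1 in H. tauto.
  - tauto.
  - split; [tauto | lia].
  - split; [tauto | lia].
Qed.

(* A step from a normal term is an eta step. *)
Lemma nf_step :
  (forall M M', step_t M M' -> nf M -> nf M' /\ size M' < size M /\
     (tail M = KApp -> tail M' = KApp) /\ (tail M <> KMu -> tail M' <> KMu) /\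
     (is_value M = true -> is_value M' = true)) /\
  (forall J J', step_j J J' -> nfj J -> nfj J' /\ sizej J' < sizej J).
Proof.
  apply step_ind; simpl.
  - intros N M H (H1 & _). destruct N; discriminate.
  - intros V N H H0 (_ & H1 & _). congruence.
  - intros M V H (H1 & _). discriminate.
  - intros M V H (_ & _ & H1). destruct V; discriminate.
  - intros M J (_ & _ & H1). discriminate.
  - intros V H (H1 & _). destruct V; try discriminate. simpl. repeat split; auto; lia.
  - intros M (_ & H & H1). rewrite H1. repeat split; auto; try discriminate; lia.
  - intros M (H & H1). rewrite (proj1 nf_ren_c) in H. rewrite tail_ren_c in H1.
    rewrite (proj1 size_ren_c). repeat split; auto; try discriminate; lia.
  - intros M M' _ IH H. apply IH in H. destruct H as (? & ? & ? & ? & ?).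
    repeat split; auto; lia.
  - intros M M' N Hs _ (H & _). destruct M; try discriminate. inversion Hs.
  - intros M N N' _ IH (H1 & H2 & H3). apply IH in H3. destruct H3 as (? & ? & ? & ? & ?).
    repeat split; auto; try lia.
  - intros L L' N _ IH (H1 & H2 & H3). apply IH in H1. destruct H1 as (? & ? & ? & ? & ?).
    repeat split; auto; try lia; discriminate.
  - intros L N N' _ IH (H1 & H2 & H3). apply IH in H2. destruct H2 as (? & ? & ? & ? & ?).
    repeat split; auto; try lia; discriminate.
  - intros J J' _ IH H. apply IH in H. destruct H as (? & ?).
    repeat split; auto; try lia; discriminate.
  - intros l J (_ & H). congruence.
  - intros k M M' _ IH (H1 & H2). apply IH in H1. destruct H1 as (? & ? & ? & ? & ?).
    repeat split; auto; lia.
  - intros J J' N _ IH (H1 & H2 & H3). apply IH in H1. destruct H1 as (? & ?).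
    repeat split; auto; lia.
  - intros J N N' _ IH (H1 & H2 & H3). apply IH in H2. destruct H2 as (? & ? & ? & ? & ?).
    repeat split; auto; lia.
Qed.

(** The steps still possible are eta steps, which strictly decrease a congruence-invariant size, so
    exhausting them ends in an irreducible term. *)
Lemma nf_normalizable n : forall M, size M < n -> nf M -> normalizable M.
Proof.
  induction n as [| n IH]; intros M Hn HM; [lia |].
  destruct (classic (exists M', red1 M M')) as [[M' HR] | HR].
  - assert (HR' := HR). destruct HR' as (N & N' & H1 & H2 & H3).
    apply nf_equiv in H1, H2. apply nf_step in H3; [| tauto].
    destruct (IH M') as (P & A & B); [lia | tauto |].
    exists P; split; auto. eapply rt_trans; [apply rt_step, HR | exact A].
  - exists M; split; auto using rt_refl.
Qed.

Lemma clos_rst_map {A B} (R : relation A) (R' : relation B) (f : A -> B) :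
  (forall x y, R x y -> R' (f x) (f y)) ->
  forall x y, clos_refl_sym_trans A R x y -> clos_refl_sym_trans B R' (f x) (f y).
Proof. intros H x y. induction 1; eauto using rst_step, rst_refl, rst_sym, rst_trans. Qed.

Lemma clos_rt_map {A B} (R : relation A) (R' : relation B) (f : A -> B) :
  (forall x y, R x y -> R' (f x) (f y)) ->
  forall x y, clos_refl_trans A R x y -> clos_refl_trans B R' (f x) (f y).
Proof. intros H x y. induction 1; eauto using rt_step, rt_refl, rt_trans. Qed.

Lemma equiv_lam M M' : tm_equiv M M' -> tm_equiv (Lam M) (Lam M').
Proof. apply clos_rst_map. constructor; auto. Qed.
Lemma equiv_appl M M' N : tm_equiv M M' -> tm_equiv (App M N) (App M' N).
Proof. apply (clos_rst_map _ _ (fun M => App M N)). constructor; auto. Qed.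
Lemma equiv_appr M N N' : tm_equiv N N' -> tm_equiv (App M N) (App M N').
Proof. apply clos_rst_map. constructor; auto. Qed.
Lemma equiv_wherel L L' N : tm_equiv L L' -> tm_equiv (WhereT L N) (WhereT L' N).
Proof. apply (clos_rst_map _ _ (fun M => WhereT M N)). constructor; auto. Qed.
Lemma equiv_wherer L N N' : tm_equiv N N' -> tm_equiv (WhereT L N) (WhereT L N').
Proof. apply clos_rst_map. constructor; auto. Qed.
Lemma equiv_mu J J' : jm_equiv J J' -> tm_equiv (Mu J) (Mu J').
Proof. apply clos_rst_map. constructor; auto. Qed.
Lemma equiv_jmp k M M' : tm_equiv M M' -> jm_equiv (Jmp k M) (Jmp k M').
Proof. apply clos_rst_map. constructor; auto. Qed.
Lemma equiv_wherejl J J' N : jm_equiv J J' -> jm_equiv (WhereJ J N) (WhereJ J' N).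
Proof. apply (clos_rst_map _ _ (fun M => WhereJ M N)). constructor; auto. Qed.
Lemma equiv_wherejr J N N' : tm_equiv N N' -> jm_equiv (WhereJ J N) (WhereJ J N').
Proof. apply clos_rst_map. constructor; auto. Qed.

(** * Redexes modulo the congruence *)

Definition redex (M : term) : Prop := exists M1 M2, tm_equiv M M1 /\ step_t M1 M2.
Definition redexj (J : jump) : Prop := exists J1 J2, jm_equiv J J1 /\ step_j J1 J2.

Lemma redex_red1 M : redex M -> exists N, red1 M N.
Proof. intros (M1 & M2 & ? & ?). exists M2, M1, M2. repeat split; auto. apply rst_refl. Qed.

Lemma redex_step M M' : step_t M M' -> redex M.
Proof. intros. exists M, M'. split; auto. apply rst_refl. Qed.

Lemma redex_lam M : redex M -> redex (Lam M).
Proof. intros (M1 & M2 & ? & ?). exists (Lam M1), (Lam M2);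
  split; [apply equiv_lam | constructor]; auto. Qed.
Lemma redex_appr M N : redex N -> redex (App M N).
Proof. intros (M1 & M2 & ? & ?). exists (App M M1), (App M M2);
  split; [apply equiv_appr | constructor]; auto. Qed.
Lemma redex_wherel L N : redex L -> redex (WhereT L N).
Proof. intros (M1 & M2 & ? & ?). exists (WhereT M1 N), (WhereT M2 N);
  split; [apply equiv_wherel | constructor]; auto. Qed.
Lemma redex_wherer L N : redex N -> redex (WhereT L N).
Proof. intros (M1 & M2 & ? & ?). exists (WhereT L M1), (WhereT L M2);
  split; [apply equiv_wherer | constructor]; auto. Qed.
Lemma redex_mu J : redexj J -> redex (Mu J).
Proof. intros (M1 & M2 & ? & ?). exists (Mu M1), (Mu M2);
  split; [apply equiv_mu | constructor]; auto. Qed.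
Lemma redexj_jmp k M : redex M -> redexj (Jmp k M).
Proof. intros (M1 & M2 & ? & ?). exists (Jmp k M1), (Jmp k M2);
  split; [apply equiv_jmp | constructor]; auto. Qed.
Lemma redexj_wherel J N : redexj J -> redexj (WhereJ J N).
Proof. intros (M1 & M2 & ? & ?). exists (WhereJ M1 N), (WhereJ M2 N);
  split; [apply equiv_wherejl | constructor]; auto. Qed.
Lemma redexj_wherer J N : redex N -> redexj (WhereJ J N).
Proof. intros (M1 & M2 & ? & ?). exists (WhereJ J M1), (WhereJ J M2);
  split; [apply equiv_wherejr | constructor]; auto. Qed.

Lemma redex_equiv M M' : tm_equiv M M' -> redex M' -> redex M.
Proof. intros H (M1 & M2 & ? & ?). exists M1, M2; split; auto. eapply rst_trans; eauto. Qed.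
Lemma redexj_equiv M M' : jm_equiv M M' -> redexj M' -> redexj M.
Proof. intros H (M1 & M2 & ? & ?). exists M1, M2; split; auto. eapply rst_trans; eauto. Qed.

(** (E1) moves the bindings inside [N] outwards until its tail is bound directly; a tail that is a
    value or a [Mu] then forms a redex with [L]. *)
Lemma redex_where_tail N : forall L, tail N <> KApp -> redex (WhereT L N).
Proof.
  induction N; simpl; intros L H; try congruence.
  - eapply redex_step, R_where_val; auto.
  - eapply redex_step, R_where_val; auto.
  - eapply redex_equiv; [apply rst_step, E1_t |]. apply redex_wherel; auto.
  - eapply redex_step, R_where_mu.
Qed.

Fixpoint flat_label (J : jump) : nat :=
  match J with Jmp k _ => k | WhereJ J _ => flat_label J end.
Fixpoint flat_body (J : jump) : term :=
  match J with Jmp _ M => M | WhereJ J N => WhereT (flat_body J) N end.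

Lemma flat_equiv J : jm_equiv J (Jmp (flat_label J) (flat_body J)).
Proof.
  induction J as [k M | J IH N]; simpl; [apply rst_refl |].
  eapply rst_trans; [apply equiv_wherejl, IH |]. apply rst_sym, rst_step, E3.
Qed.

Lemma redexj_where_tail N J : tail N <> KApp -> redexj (WhereJ J N).
Proof.
  intros H. eapply redexj_equiv; [apply (flat_equiv (WhereJ J N)) |]. simpl.
  apply redexj_jmp, redex_where_tail, H.
Qed.

Lemma redexj_jmp_tail M : forall k, tail M = KMu -> redexj (Jmp k M).
Proof.
  induction M; simpl; intros k H; try discriminate.
  - eapply redexj_equiv; [apply rst_step, E3 |]. apply redexj_wherel; auto.
  - do 2 eexists; split; [apply rst_refl | apply R_jmp_mu].
Qed.

Lemma tail_eq_dec (a b : kind) : {a = b} + {a <> b}.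
Proof. decide equality. Qed.

Lemma irreducible_nf :
  (forall M, ~ redex M -> nf M) /\ (forall J, ~ redexj J -> nfj J).
Proof.
  apply term_jump_ind; simpl.
  - auto.
  - intros M IH H. apply IH. auto using redex_lam.
  - intros M IHM N IHN H.
    destruct (is_value M) eqn:HM.
    2:{ exfalso; apply H. eapply redex_step, R_app_l; auto. }
    destruct (is_value N) eqn:HN.
    2:{ exfalso; apply H. eapply redex_step, R_app_r; auto. }
    repeat split; auto using redex_appr.
    destruct M; try discriminate; auto. exfalso; apply H.
    eapply redex_step, R_beta; auto.
  - intros L IHL N IHN H. repeat split; auto using redex_wherel, redex_wherer.
    destruct (tail_eq_dec (tail N) KApp); auto. exfalso; auto using redex_where_tail.
  - intros J IH H. auto using redex_mu.
  - intros k M IH H. split; auto using redexj_jmp, redexj_jmp_tail.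
  - intros J IHJ N IHN H. repeat split; auto using redexj_wherel, redexj_wherer.
    destruct (tail_eq_dec (tail N) KApp); auto. exfalso; apply H, redexj_where_tail; auto.
Qed.

(** * Good types for normal forms *)

Definition gctx (G : nat -> sub) (D : nat -> ty) : Prop :=
  (forall x, sgood (G x)) /\ (forall k, tgood (D k)).

Lemma sgood_app s s' : sgood s -> sgood s' -> sgood (s ++ s').
Proof.
  rewrite !sgood_iff. intros [H1 H2] [H3 H4]. split; [destruct s; simpl; congruence |].
  intros r Hr. apply in_app_or in Hr. destruct Hr; auto.
Qed.

Lemma tgood_app s s' : tgood s -> tgood s' -> tgood (s ++ s').
Proof.
  rewrite !tgood_iff. intros [H1 H2] [H3 H4]. split; [destruct s; simpl; congruence |].
  intros r Hr. apply in_app_or in Hr. destruct Hr; auto.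
Qed.

Lemma tgood_1 s : sgood s -> tgood [s].
Proof. intros H. apply tgood_iff. split; [discriminate |]. intros x [<- | []]; auto. Qed.

Lemma sgood_Arr s T : sgood s -> tgood T -> sgood [Arr s T].
Proof.
  intros H1 H2. apply sgood_iff. split; [discriminate |]. intros x [<- | []].
  apply raw_bad_Arr; auto.
Qed.

Definition gapp (G1 G2 : nat -> sub) (x : nat) : sub := G1 x ++ G2 x.
Definition dapp (D1 D2 : nat -> ty) (k : nat) : ty := D1 k ++ D2 k.

Lemma gctx_app G1 G2 D1 D2 : gctx G1 D1 -> gctx G2 D2 ->
  gctx (gapp G1 G2) (dapp D1 D2).
Proof. intros [A B] [C E]. split; intros x; [apply sgood_app | apply tgood_app]; auto. Qed.

Lemma dle_app_l D1 D2 : dle D1 (dapp D1 D2).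
Proof. intros k. apply tle_app_l. Qed.

Lemma dle_app_r D1 D2 : dle D2 (dapp D1 D2).
Proof. intros k. apply tle_app_r. Qed.

Lemma scons_eta {A} (f : nat -> A) : f 0 .: (fun n => f (S n)) = f.
Proof. extensionality n. destruct n; reflexivity. Qed.

Lemma den_where_merge L N G1 D1 G2 D2 T :
  den G1 D1 L T -> den G2 D2 N [G1 0] ->
  den (gapp (fun x => G1 (S x)) G2) (dapp D1 D2) (WhereT L N) T.
Proof.
  intros H1 H2. exists [G1 0]; split.
  - eapply den_weaken; [| | | exact H2]; auto using dle_app_r. apply gle_app_r.
  - intros s [<- | []]. eapply den_weaken; [| | | exact H1]; auto using dle_app_l.
    intros [| x]; simpl; auto. apply (gle_app_l (fun x => G1 (S x)) G2).
Qed.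

Lemma denj_where_merge J N G1 D1 G2 D2 :
  denj G1 D1 J -> den G2 D2 N [G1 0] ->
  denj (gapp (fun x => G1 (S x)) G2) (dapp D1 D2) (WhereJ J N).
Proof.
  intros H1 H2. exists [G1 0]; split.
  - eapply den_weaken; [| | | exact H2]; auto using dle_app_r. apply gle_app_r.
  - intros s [<- | []]. eapply denj_weaken; [| | exact H1]; auto using dle_app_l.
    intros [| x]; simpl; auto. apply (gle_app_l (fun x => G1 (S x)) G2).
Qed.

Lemma gctx_shift G D : gctx G D -> gctx (fun x => G (S x)) D.
Proof. intros [A B]; split; auto. Qed.

(** A normal term whose tail is an application has a variable at its head, whose result type is
    free; hence such a term takes any good type. This freedom lets a bound term meet the type that
    the body requires of its variable. *)
Lemma nf_typable :
  (forall M, nf M ->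
     (exists G D T, den G D M T /\ gctx G D /\ tgood T) /\
     (tail M = KApp -> forall T, tgood T -> exists G D, den G D M T /\ gctx G D)) /\
  (forall J, nfj J -> exists G D, denj G D J /\ gctx G D).
Proof.
  apply term_jump_ind; simpl.
  - intros x _. split; [| discriminate].
    exists (fun _ => [Atom 0]), (fun _ => [[Atom 0]]), [[Atom 0]].
    repeat split. exists [Atom 0]; simpl; auto.
  - intros M IH H. split; [| discriminate].
    destruct (IH H) as ((G & D & T & H1 & H2 & H3) & _).
    exists (fun x => G (S x)), D, [[Arr (G 0) T]]. split; [| split].
    + exists [Arr (G 0) T]; simpl; split; auto. intros r [<- | []].
      exists (G 0), T; split; auto. rewrite scons_eta. exact H1.
    + apply gctx_shift, H2.
    + apply tgood_1, sgood_Arr; auto. apply H2.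
  - intros M _ N IH (HM & HN & H).
    assert (K : forall T, tgood T -> exists G D, den G D (App M N) T /\ gctx G D).
    { destruct M as [y | | | |]; try discriminate. intros T HT.
      destruct (IH H) as ((G & D & T' & H1 & H2 & H3) & _).
      apply value_den_prime in H1; auto. destruct H1 as (s & Hs & H1).
      assert (Hgs : sgood s). { rewrite tgood_iff in H3. apply H3; auto. }
      exists (gapp G (fun _ => [Arr s T])), D. split.
      (* The arrow was added to the type of every variable, not only to that of the head [y]:
         intersecting can only strengthen the context. *)
      - exists [[Arr s T]]. split.
        + exists [Arr s T]; simpl; split; auto. apply (gle_app_r G (fun _ => [Arr s T])).
        + intros A [<- | []]. exists [s]; split.
          * eapply den_weaken; [| | | exact H1]; auto. apply gle_app_l.
          * intros U [<- | []]; auto.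
      - destruct H2 as [A B]. split; auto. intros x.
        apply sgood_app; auto using sgood_Arr. }
    split; auto. destruct (K [[Atom 0]]) as (G & D & ? & ?); [reflexivity |].
    exists G, D, [[Atom 0]]. repeat split; try assumption; apply H1.
  - intros L IHL N IHN (H1 & H2 & H3).
    destruct (IHL H1) as (A & B). destruct (IHN H2) as (_ & C). split.
    + destruct A as (G1 & D1 & T & E1 & E2 & E3).
      destruct (C H3 [G1 0]) as (G2 & D2 & F1 & F2). { apply tgood_1, E2. }
      do 2 eexists; exists T; split; [exact (den_where_merge _ _ _ _ _ _ _ E1 F1) |].
      split; auto. apply gctx_app; auto. apply gctx_shift; auto.
    + intros HL T HT. destruct (B HL T HT) as (G1 & D1 & E1 & E2).
      destruct (C H3 [G1 0]) as (G2 & D2 & F1 & F2). { apply tgood_1, E2. }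
      do 2 eexists; split; [exact (den_where_merge _ _ _ _ _ _ _ E1 F1) |].
      apply gctx_app; auto. apply gctx_shift; auto.
  - intros J IH H. split; [| discriminate]. destruct (IH H) as (G & D & H1 & H2 & H3).
    exists G, (fun k => D (S k)), (D 0). rewrite scons_eta. split; auto.
    split; [split |]; auto.
  - intros k M IH (H & _). destruct (IH H) as ((G & D & T & H1 & H2 & H3) & _).
    exists G, (dapp D (fun _ => T)). split.
    (* Every continuation type was enlarged by [T], so in particular [k] accepts [M]. *)
    + eapply den_weaken; [| | | exact H1]; auto using dle_app_l. apply tle_app_r.
    + destruct H2; split; auto. intros x. apply tgood_app; auto.
  - intros J IHJ N IHN (H1 & H2 & H3).
    destruct (IHJ H1) as (G1 & D1 & E1 & E2). destruct (IHN H2) as (_ & C).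
    destruct (C H3 [G1 0]) as (G2 & D2 & F1 & F2). { apply tgood_1, E2. }
    do 2 eexists; split; [exact (denj_where_merge _ _ _ _ _ _ E1 F1) |].
    apply gctx_app; auto. apply gctx_shift; auto.
Qed.

Lemma normalizable_good_typable M : normalizable M -> good_typable M.
Proof.
  intros (N & HR & HN). apply clos_rt_rt1n in HR. induction HR as [| M M' N' H HR IH].
  - assert (H : nf x). { apply irreducible_nf. intros H. apply HN, redex_red1, H. }
    apply nf_typable in H. destruct H as ((G & D & T & H1 & [H2 H3] & H4) & _).
    exists G, D, T. auto.
  - eapply good_typable_red1; eauto.
Qed.

(** * Terminating evaluation implies typability *)

Lemma e3_equiv :
  (forall M, tm_equiv M (e3_t M)) /\
  (forall J, jm_equiv J (Jmp (fst (e3_j J)) (snd (e3_j J)))).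
Proof.
  apply term_jump_ind; simpl; intros.
  - apply rst_refl.
  - apply equiv_lam; auto.
  - eapply rst_trans; [apply equiv_appl | apply equiv_appr]; eauto.
  - eapply rst_trans; [apply equiv_wherel | apply equiv_wherer]; eauto.
  - destruct (e3_j j). apply equiv_mu; auto.
  - apply equiv_jmp; auto.
  - destruct (e3_j j). simpl in *.
    eapply rst_trans; [apply equiv_wherejl; eauto |].
    eapply rst_trans; [apply equiv_wherejr; eauto |].
    apply rst_sym, rst_step, E3.
Qed.

(** [e_step] looks below a [Mu] only through [Jmp], so [Mu (WhereJ J N)] is stuck merely by its
    shape. Canonical readings exclude this, and evaluation preserves them. *)
Fixpoint e3n (M : term) : Prop :=
  match M with
  | Var _ => True
  | Lam M => e3n M
  | App M N | WhereT M N => e3n M /\ e3n N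
  | Mu J => e3nj J
  end
with e3nj (J : jump) : Prop :=
  match J with Jmp _ M => e3n M | WhereJ _ _ => False end.

Lemma e3n_e3 : (forall M, e3n (e3_t M)) /\ (forall J, e3n (snd (e3_j J))).
Proof.
  apply term_jump_ind; simpl; intros; auto; destruct (e3_j j); simpl in *; auto.
Qed.

Lemma e3n_ren_o : (forall M xi, e3n M -> e3n (ren_o xi M)) /\
  (forall J xi, e3nj J -> e3nj (ren_oj xi J)).
Proof. apply term_jump_ind; simpl; intuition. Qed.

Lemma e3n_ren_c : (forall M xi, e3n M -> e3n (ren_c xi M)) /\
  (forall J xi, e3nj J -> e3nj (ren_cj xi J)).
Proof. apply term_jump_ind; simpl; intuition. Qed.

Lemma e3n_subst_o :
  (forall M theta, (forall x, e3n (theta x)) -> e3n M -> e3n (subst_o theta M)) /\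
  (forall J theta, (forall x, e3n (theta x)) -> e3nj J -> e3nj (subst_oj theta J)).
Proof.
  assert (U : forall theta, (forall x, e3n (theta x)) -> forall x, e3n (up_o theta x)).
  { intros theta H [| x]; simpl; auto. apply e3n_ren_o; auto. }
  assert (C : forall theta, (forall x, e3n (theta x)) -> forall x, e3n (up_c theta x)).
  { intros theta H x. apply e3n_ren_c; auto. }
  apply term_jump_ind; simpl; intuition.
Qed.

Lemma e3n_cs :
  (forall M k P, e3n P -> e3n M -> e3n (cs_t k P M)) /\
  (forall J k P, e3n P -> e3nj J -> e3nj (cs_j k P J)).
Proof.
  assert (A := proj1 e3n_ren_o). assert (B := proj1 e3n_ren_c).
  apply term_jump_ind; simpl; intuition.
  destruct (n =? k); simpl; auto.
Qed.

Lemma e3n_e0_step M M' : e0_step M M' -> e3n M -> e3n M'.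
Proof.
  assert (A := proj1 e3n_ren_o).
  induction 1; simpl in *; intuition.
  - apply e3n_subst_o; auto. intros [| x]; simpl; auto.
  - apply e3n_cs; auto. apply e3n_ren_c; auto.
Qed.

Lemma e3n_e_step M M' : e_step M M' -> e3n M -> e3n M'.
Proof.
  destruct 1; simpl; intros.
  - apply e3n_ren_c; auto.
  - eapply e3n_e0_step; eauto.
  - eapply e3n_e0_step; eauto.
Qed.

Lemma e0_step_step M M' : e0_step M M' -> step_t M M'.
Proof. induction 1; constructor; auto. Qed.

Lemma e_step_step M M' : e_step M M' -> step_t M M'.
Proof. destruct 1; repeat constructor; auto using e0_step_step. Qed.

Lemma value_den_omega G D V : is_value V = true -> den G D V [[]].
Proof. intros HV. apply value_den_inter; auto. intros r []. Qed.

(** Every variable has type omega -> mho. A blocked non-value has, at its evaluation position, a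
    variable applied to a value, hence has type mho. Mho propagates outwards through every frame,
    because conditions ranging over the members of an empty union are vacuous. *)
Lemma stuck_den D M : is_value M = false -> (forall J, M <> Mu J) ->
  (~ exists M', e0_step M M') -> den (fun _ => [Arr [] []]) D M [].
Proof.
  induction M as [x | M _ | M IHM N IHN | L _ N IHN | J]; simpl; intros HV HJ HN;
    try discriminate.
  - destruct (is_value M) eqn:HM.
    + destruct (is_value N) eqn:EN.
      * destruct M as [y | M | | |]; try discriminate.
        -- exists [[Arr [] []]]; split.
           ++ exists [Arr [] []]; simpl; auto.
           ++ intros A [<- | []]. exists [[]]; split; [apply value_den_omega; auto |].
              intros U [<- | []]; auto.
        -- exfalso; apply HN. eexists; apply E0_beta; auto.
      (* [V] has omega and [N] has mho: with no member in the argument type, nothing is asked of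
         [V]. *)
      * exists [[]]; split; [apply value_den_omega; auto |].
        intros A _. exists []; split; [| intros U []]. apply IHN; auto.
        -- intros J ->. apply HN. eexists; apply E0_val_mu; auto.
        -- intros [N' HN']. apply HN. eexists; apply E0_ctx_arg; eauto.
    + exists []; split; [| intros A []]. apply IHM; auto.
      * intros J ->. apply HN. eexists; apply E0_mu_app.
      * intros [M' HM']. apply HN. eexists; apply E0_ctx_fun; eauto.
  - exists []; split; [| intros s []]. destruct (is_value N) eqn:EN.
    + exfalso; apply HN. eexists; apply E0_where_val; auto.
    + apply IHN; auto.
      * intros J ->. apply HN. eexists; apply E0_where_mu.
      * intros [N' HN']. apply HN. eexists; apply E0_ctx_where; eauto.
  - exfalso; eapply HJ; reflexivity.
Qed.

Lemma stuck_den_omega D M : (forall J, M <> Mu J) ->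
  (~ exists M', e0_step M M') -> den (fun _ => [Arr [] []]) D M [[]].
Proof.
  intros HJ HN. destruct (is_value M) eqn:HV; [apply value_den_omega; auto |].
  eapply den_weaken; [| | | apply (stuck_den D); auto]; auto. intros s [].
Qed.

Lemma stuck_typable M : e3n M -> (~ exists M', e_step M M') -> typable M.
Proof.
  (* Continuations accept the union whose one member is omega; both values and terms of type mho
     have it. The bound continuation has the same type as the free ones, so the label [l] does not
     matter. *)
  intros HE HN. exists (fun _ => [Arr [] []]), (fun _ => [[]]), [[]].
  destruct (classic (exists J, M = Mu J)) as [[J ->] | HJ].
  - destruct J as [l L | J N]; [| destruct HE]. simpl.
    replace (([[]] .: (fun _ => [[]])) l) with [@nil raw] by (destruct l; reflexivity).
    apply stuck_den_omega.
    + intros J ->. apply HN. eexists; apply E_mu_mu.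
    + intros [M' H]. apply HN. eexists; apply E_under; eauto.
  - apply stuck_den_omega; eauto. intros [M' H]. apply HN. eexists; apply E_e0; eauto.
Qed.

Lemma cbv_terminates_typable M : cbv_terminates M -> typable M.
Proof.
  intros (N & HR & HN).
  assert (HE : e3n (e3_t M)) by apply e3n_e3.
  assert (H : typable (e3_t M)).
  { apply clos_rt_rt1n in HR. induction HR as [x | x y z H HR IH].
    - apply stuck_typable; auto.
    - eapply typable_expand; [apply e_step_step, H |].
      apply IH; auto. eapply e3n_e_step; eauto. }
  destruct H as (G & D & T & H). exists G, D, T.
  apply (den_equiv M (e3_t M)); auto. apply e3_equiv.
Qed.

(** * A continuation-passing target *)

(* [Tl t] abstracts the argument (index 0) and the continuation (index 1);
   [Tk t] is a continuation; [Th k w] passes [w] to [k]; [Ta v w k] applies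
   [v] to [w] with return continuation [k].  Both kinds of variables share one
   index space. *)
Inductive tm : Type :=
| Tv : nat -> tm
| Tl : tm -> tm
| Tk : tm -> tm
| Th : tm -> tm -> tm
| Ta : tm -> tm -> tm -> tm.

Fixpoint tren (xi : nat -> nat) (t : tm) : tm :=
  match t with
  | Tv n => Tv (xi n)
  | Tl t => Tl (tren (upren (upren xi)) t)
  | Tk t => Tk (tren (upren xi) t)
  | Th k w => Th (tren xi k) (tren xi w)
  | Ta v w k => Ta (tren xi v) (tren xi w) (tren xi k)
  end.

Definition tshift : tm -> tm := tren S.
Definition shift (s : nat -> tm) (n : nat) : tm := tshift (s n).
Definition tup (s : nat -> tm) : nat -> tm := Tv 0 .: shift s.

Fixpoint tsub (s : nat -> tm) (t : tm) : tm :=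
  match t with
  | Tv n => s n
  | Tl t => Tl (tsub (tup (tup s)) t)
  | Tk t => Tk (tsub (tup s) t)
  | Th k w => Th (tsub s k) (tsub s w)
  | Ta v w k => Ta (tsub s v) (tsub s w) (tsub s k)
  end.

Lemma tup_ren xi : tup (fun n => Tv (xi n)) = fun n => Tv (upren xi n).
Proof. extensionality n. destruct n; reflexivity. Qed.

Lemma tren_tsub t : forall xi, tren xi t = tsub (fun n => Tv (xi n)) t.
Proof. induction t; intros; simpl; rewrite ?tup_ren; f_equal; auto. Qed.

Lemma tsub_id t : tsub Tv t = t.
Proof.
  assert (tup Tv = Tv) as E. { extensionality n. destruct n; reflexivity. }
  induction t; simpl; rewrite ?E; f_equal; auto.
Qed.

Lemma tsub_tren t : forall s xi, tsub s (tren xi t) = tsub (fun n => s (xi n)) t.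
Proof.
  assert (E : forall s xi, (fun n => tup s (upren xi n)) = tup (fun n => s (xi n))).
  { intros. extensionality n. destruct n; reflexivity. }
  induction t; intros; simpl; f_equal; auto; rewrite IHt, ?E; auto.
Qed.

Lemma tren_tren t xi zeta : tren zeta (tren xi t) = tren (fun n => zeta (xi n)) t.
Proof. rewrite (tren_tsub _ zeta), tsub_tren, tren_tsub. reflexivity. Qed.

Lemma tren_tsub_comp t : forall s xi, tren xi (tsub s t) = tsub (fun n => tren xi (s n)) t.
Proof.
  assert (E : forall s xi, (fun n => tren (upren xi) (tup s n)) = tup (fun n => tren xi (s n))).
  { intros. extensionality n. destruct n; [reflexivity |]. simpl. unfold shift, tshift.
    rewrite !tren_tren. reflexivity. }
  induction t; intros; simpl; f_equal; auto; rewrite IHt, ?E; auto.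
Qed.

Lemma tsub_tshift s a t : tsub (a .: s) (tshift t) = tsub s t.
Proof. unfold tshift. rewrite tsub_tren. reflexivity. Qed.

Lemma tsub_tup_tshift s t : tsub (tup s) (tshift t) = tshift (tsub s t).
Proof. unfold tshift. rewrite tsub_tren, tren_tsub_comp. reflexivity. Qed.

Definition inst (t w : tm) : tm := tsub (w .: Tv) t.
Definition inst2 (t w k : tm) : tm := tsub (w .: k .: Tv) t.

Definition sub_all (s : nat -> tm) (f : nat -> tm) (n : nat) : tm := tsub s (f n).

Lemma sub_all_scons s a f : sub_all s (a .: f) = tsub s a .: sub_all s f.
Proof. extensionality n. destruct n; reflexivity. Qed.

Lemma sub_all_shift s f : sub_all (tup s) (shift f) = shift (sub_all s f).
Proof. extensionality n. apply tsub_tup_tshift. Qed.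

Lemma sub_all_tup s f : sub_all (tup s) (tup f) = tup (sub_all s f).
Proof. unfold tup at 2 3. rewrite sub_all_scons, sub_all_shift. reflexivity. Qed.

(* [C s c M k] is the translation of [M] passed to the continuation [k], under
   an assignment [s] for ordinary and [c] for continuation variables.  No
   redex is created for the value positions of an application. *)
Fixpoint C (s c : nat -> tm) (M : term) (k : tm) : tm :=
  let cval (s c : nat -> tm) (V : term) : tm :=
    match V with
    | Var x => s x
    | Lam M => Tl (C (Tv 0 .: shift (shift s)) (shift (shift c)) M (Tv 1))
    | _ => Tv 0
    end in
  match M with
  | Var x => Th k (s x)
  | Lam M => Th k (Tl (C (Tv 0 .: shift (shift s)) (shift (shift c)) M (Tv 1)))
  | App M N =>
      if is_value M then
        if is_value N then Ta (cval s c M) (cval s c N) k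
        else C s c N (Tk (Ta (tshift (cval s c M)) (Tv 0) (tshift k)))
      else
        C s c M (Tk (if is_value N
          then Ta (Tv 0) (tshift (cval s c N)) (tshift k)
          else C (shift s) (shift c) N (Tk (Ta (Tv 1) (Tv 0) (tshift (tshift k))))))
  | WhereT L N => C s c N (Tk (C (tup s) (shift c) L (tshift k)))
  | Mu J => Cj s (k .: c) J
  end
with Cj (s c : nat -> tm) (J : jump) : tm :=
  match J with
  | Jmp k M => C s c M (c k)
  | WhereJ J N => C s c N (Tk (Cj (tup s) (shift c) J))
  end.

(** The value translation local to [C], named so that lemmas can speak of it. It is consulted only
    for values; [Tv 0] is a filler. *)
Definition cval (s c : nat -> tm) (V : term) : tm :=
  match V with
  | Var x => s x
  | Lam M => Tl (C (Tv 0 .: shift (shift s)) (shift (shift c)) M (Tv 1))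
  | _ => Tv 0
  end.

Lemma C_value s c V k : is_value V = true -> C s c V k = Th k (cval s c V).
Proof. destruct V; simpl; try discriminate; reflexivity. Qed.

Lemma C_App s c M N k : C s c (App M N) k =
  if is_value M then
    if is_value N then Ta (cval s c M) (cval s c N) k
    else C s c N (Tk (Ta (tshift (cval s c M)) (Tv 0) (tshift k)))
  else
    C s c M (Tk (if is_value N
      then Ta (Tv 0) (tshift (cval s c N)) (tshift k)
      else C (shift s) (shift c) N (Tk (Ta (Tv 1) (Tv 0) (tshift (tshift k)))))).
Proof. reflexivity. Qed.

(** * Compatibility of the translation with substitutions *)

Lemma C_tsub_all :
  (forall M t s c k, tsub t (C s c M k) = C (sub_all t s) (sub_all t c) M (tsub t k)) /\
  (forall J t s c, tsub t (Cj s c J) = Cj (sub_all t s) (sub_all t c) J).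
Proof.
  apply term_jump_ind.
  - reflexivity.
  - intros M IH t s c k. simpl. rewrite IH, sub_all_scons, !sub_all_shift. reflexivity.
  - intros M IHM N IHN t s c k.
    (* [cval] has no induction of its own: by [C_value] its equation is the argument part of the
       equation for [C], obtained by injectivity of [Th]. The same extraction serves the analogous
       lemmas below. *)
    assert (VM : is_value M = true ->
      forall t s c, tsub t (cval s c M) = cval (sub_all t s) (sub_all t c) M).
    { intros HV t0 s0 c0. specialize (IHM t0 s0 c0 (Tv 0)).
      rewrite !C_value in IHM by auto. injection IHM; auto. }
    assert (VN : is_value N = true ->
      forall t s c, tsub t (cval s c N) = cval (sub_all t s) (sub_all t c) N).
    { intros HV t0 s0 c0. specialize (IHN t0 s0 c0 (Tv 0)).
      rewrite !C_value in IHN by auto. injection IHN; auto. }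
    rewrite !C_App. destruct (is_value M), (is_value N); simpl;
      rewrite ?IHM, ?IHN; simpl; rewrite ?tsub_tup_tshift, ?IHN, ?VM, ?VN by auto;
      simpl; rewrite ?sub_all_shift, ?tsub_tup_tshift; reflexivity.
  - intros L IHL N IHN t s c k. simpl. rewrite IHN. simpl.
    rewrite IHL, sub_all_tup, sub_all_shift, tsub_tup_tshift. reflexivity.
  - intros J IH t s c k. simpl. rewrite IH, sub_all_scons. reflexivity.
  - intros l M IH t s c. simpl. rewrite IH. reflexivity.
  - intros J IHJ N IHN t s c. simpl. rewrite IHN. simpl.
    rewrite IHJ, sub_all_tup, sub_all_shift. reflexivity.
Qed.

Lemma C_tsub M t s c k : tsub t (C s c M k) = C (sub_all t s) (sub_all t c) M (tsub t k).
Proof. apply C_tsub_all. Qed.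

Lemma cval_tsub V t s c : is_value V = true ->
  tsub t (cval s c V) = cval (sub_all t s) (sub_all t c) V.
Proof.
  intros HV. assert (H := C_tsub V t s c (Tv 0)).
  rewrite !C_value in H by auto. injection H; auto.
Qed.

Lemma sub_all_ren f : sub_all (fun n => Tv (S n)) f = shift f.
Proof. extensionality n. unfold shift, tshift. rewrite tren_tsub. reflexivity. Qed.

Lemma cval_tshift V s c : is_value V = true ->
  tshift (cval s c V) = cval (shift s) (shift c) V.
Proof.
  intros HV. unfold tshift. rewrite tren_tsub, cval_tsub, !sub_all_ren by auto. reflexivity.
Qed.

Lemma tup_upren s xi : (fun x => tup s (upren xi x)) = tup (fun x => s (xi x)).
Proof. extensionality n. destruct n; reflexivity. Qed.

Lemma C_ren_o_all :
  (forall M xi s c k, C s c (ren_o xi M) k = C (fun x => s (xi x)) c M k) /\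
  (forall J xi s c, Cj s c (ren_oj xi J) = Cj (fun x => s (xi x)) c J).
Proof.
  apply term_jump_ind.
  - reflexivity.
  - intros M IH xi s c k. simpl. rewrite IH, scons_upren. reflexivity.
  - intros M IHM N IHN xi s c k.
    assert (VM : is_value M = true ->
      forall s c, cval s c (ren_o xi M) = cval (fun x => s (xi x)) c M).
    { intros HV s0 c0. specialize (IHM xi s0 c0 (Tv 0)).
      rewrite !C_value in IHM by (rewrite ?is_value_ren_o; auto). injection IHM; auto. }
    assert (VN : is_value N = true ->
      forall s c, cval s c (ren_o xi N) = cval (fun x => s (xi x)) c N).
    { intros HV s0 c0. specialize (IHN xi s0 c0 (Tv 0)).
      rewrite !C_value in IHN by (rewrite ?is_value_ren_o; auto). injection IHN; auto. }
    simpl ren_o. rewrite !C_App, !is_value_ren_o.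
    destruct (is_value M), (is_value N); rewrite ?IHM, ?IHN, ?VM, ?VN by auto; reflexivity.
  - intros L IHL N IHN xi s c k. simpl. rewrite IHN, IHL, tup_upren. reflexivity.
  - intros J IH xi s c k. simpl. apply IH.
  - intros l M IH xi s c. simpl. apply IH.
  - intros J IHJ N IHN xi s c. simpl. rewrite IHN, IHJ, tup_upren. reflexivity.
Qed.

Lemma C_ren_o M xi s c k : C s c (ren_o xi M) k = C (fun x => s (xi x)) c M k.
Proof. apply C_ren_o_all. Qed.

Lemma C_ren_c_all :
  (forall M xi s c k, C s c (ren_c xi M) k = C s (fun x => c (xi x)) M k) /\
  (forall J xi s c, Cj s c (ren_cj xi J) = Cj s (fun x => c (xi x)) J).
Proof.
  apply term_jump_ind.
  - reflexivity.
  - intros M IH xi s c k. simpl. rewrite IH. reflexivity.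
  - intros M IHM N IHN xi s c k.
    assert (VM : is_value M = true ->
      forall s c, cval s c (ren_c xi M) = cval s (fun x => c (xi x)) M).
    { intros HV s0 c0. specialize (IHM xi s0 c0 (Tv 0)).
      rewrite !C_value in IHM by (rewrite ?is_value_ren_c; auto). injection IHM; auto. }
    assert (VN : is_value N = true ->
      forall s c, cval s c (ren_c xi N) = cval s (fun x => c (xi x)) N).
    { intros HV s0 c0. specialize (IHN xi s0 c0 (Tv 0)).
      rewrite !C_value in IHN by (rewrite ?is_value_ren_c; auto). injection IHN; auto. }
    simpl ren_c. rewrite !C_App, !is_value_ren_c.
    destruct (is_value M), (is_value N); rewrite ?IHM, ?IHN, ?VM, ?VN by auto; reflexivity.
  - intros L IHL N IHN xi s c k. simpl. rewrite IHN, IHL. reflexivity.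
  - intros J IH xi s c k. simpl. rewrite IH, scons_upren. reflexivity.
  - intros l M IH xi s c. simpl. apply IH.
  - intros J IHJ N IHN xi s c. simpl. rewrite IHN, IHJ. reflexivity.
Qed.

Lemma C_ren_c M xi s c k : C s c (ren_c xi M) k = C s (fun x => c (xi x)) M k.
Proof. apply C_ren_c_all. Qed.

Lemma cval_ren_o V xi s c : is_value V = true ->
  cval s c (ren_o xi V) = cval (fun x => s (xi x)) c V.
Proof.
  intros HV. assert (H := C_ren_o V xi s c (Tv 0)).
  rewrite !C_value in H by (rewrite ?is_value_ren_o; auto). injection H; auto.
Qed.

Lemma cval_ren_c V xi s c : is_value V = true ->
  cval s c (ren_c xi V) = cval s (fun x => c (xi x)) V.
Proof.
  intros HV. assert (H := C_ren_c V xi s c (Tv 0)).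
  rewrite !C_value in H by (rewrite ?is_value_ren_c; auto). injection H; auto.
Qed.

Lemma is_value_subst_o theta M : (forall x, is_value (theta x) = true) ->
  is_value (subst_o theta M) = is_value M.
Proof. intros H; destruct M; simpl; auto. Qed.

Lemma cval_up_o theta s c a : (forall x, is_value (theta x) = true) ->
  (fun x => cval (a .: s) c (up_o theta x)) = a .: (fun x => cval s c (theta x)).
Proof.
  intros H. extensionality n. destruct n; [reflexivity |]. simpl.
  rewrite cval_ren_o; auto.
Qed.

Lemma cval_up_c theta s c a : (forall x, is_value (theta x) = true) ->
  (fun x => cval s (a .: c) (up_c theta x)) = (fun x => cval s c (theta x)).
Proof.
  intros H. extensionality n. unfold up_c. rewrite cval_ren_c; auto.
Qed.

Lemma shift_cval theta s c : (forall x, is_value (theta x) = true) ->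
  shift (fun x => cval s c (theta x)) = fun x => cval (shift s) (shift c) (theta x).
Proof. intros H. extensionality n. apply cval_tshift; auto. Qed.

(** Substituting values in the source is a change of environment in the target; no target step is
    involved. *)
Lemma C_subst_o_all :
  (forall M theta s c k, (forall x, is_value (theta x) = true) ->
     C s c (subst_o theta M) k = C (fun x => cval s c (theta x)) c M k) /\
  (forall J theta s c, (forall x, is_value (theta x) = true) ->
     Cj s c (subst_oj theta J) = Cj (fun x => cval s c (theta x)) c J).
Proof.
  apply term_jump_ind.
  - intros x theta s c k H. simpl. apply C_value; auto.
  - intros M IH theta s c k H. simpl.
    rewrite IH, cval_up_o, !shift_cval by auto using is_value_up_o. reflexivity.
  - intros M IHM N IHN theta s c k H.
    assert (VM : is_value M = true ->
      forall s c, cval s c (subst_o theta M) = cval (fun x => cval s c (theta x)) c M).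
    { intros HV s0 c0. specialize (IHM theta s0 c0 (Tv 0) H).
      rewrite !C_value in IHM by (rewrite ?is_value_subst_o; auto). injection IHM; auto. }
    assert (VN : is_value N = true ->
      forall s c, cval s c (subst_o theta N) = cval (fun x => cval s c (theta x)) c N).
    { intros HV s0 c0. specialize (IHN theta s0 c0 (Tv 0) H).
      rewrite !C_value in IHN by (rewrite ?is_value_subst_o; auto). injection IHN; auto. }
    simpl subst_o. rewrite !C_App, !is_value_subst_o by auto.
    destruct (is_value M), (is_value N); rewrite ?IHM, ?IHN, ?VM, ?VN by auto;
      rewrite ?shift_cval by auto; reflexivity.
  - intros L IHL N IHN theta s c k H. simpl.
    rewrite IHN, IHL by auto using is_value_up_o. unfold tup.
    rewrite cval_up_o, shift_cval by auto. reflexivity.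
  - intros J IH theta s c k H. simpl. rewrite IH, cval_up_c by auto using is_value_up_c.
    reflexivity.
  - intros l M IH theta s c H. simpl. auto.
  - intros J IHJ N IHN theta s c H. simpl.
    rewrite IHN, IHJ by auto using is_value_up_o. unfold tup.
    rewrite cval_up_o, shift_cval by auto. reflexivity.
Qed.

Lemma C_subst1 M V s c k : is_value V = true ->
  C s c (subst_o (subst1 V) M) k = C (cval s c V .: s) c M k.
Proof.
  intros HV. rewrite (proj1 C_subst_o_all).
  - f_equal. extensionality n. destruct n; reflexivity.
  - intros [| x]; simpl; auto.
Qed.

(** The continuation that binds its argument in [P] and passes the result of [P] to [k]. *)
Definition kframe (s c : nat -> tm) (P : term) (k : tm) : tm :=
  Tk (C (tup s) (shift c) P (tshift k)).

Lemma tshift_kframe s c P k : tshift (kframe s c P k) =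
  kframe (shift s) (shift c) P (tshift k).
Proof.
  unfold kframe. unfold tshift at 1. rewrite tren_tsub. simpl.
  rewrite C_tsub, tup_ren. f_equal. f_equal.
  - extensionality n. unfold sub_all. rewrite <- tren_tsub. destruct n; [reflexivity |].
    simpl. unfold shift, tshift. rewrite !tren_tren. reflexivity.
  - extensionality n. unfold sub_all, shift, tshift. rewrite <- tren_tsub, !tren_tren. reflexivity.
  - unfold tshift. rewrite <- tren_tsub, !tren_tren. reflexivity.
Qed.

Lemma kframe_ren_o a s c P k :
  kframe (a .: s) c (ren_o (upren S) P) k = kframe s c P k.
Proof. unfold kframe. rewrite C_ren_o, tup_upren. reflexivity. Qed.

Lemma kframe_ren_c a s c P k :
  kframe s (a .: c) (ren_c S P) k = kframe s c P k.
Proof. unfold kframe. rewrite C_ren_c. reflexivity. Qed.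

Lemma shift_upd k a c : shift (upd k a c) = upd k (tshift a) (shift c).
Proof. extensionality n. unfold shift, upd. destruct (n =? k); reflexivity. Qed.

Lemma is_value_cs k P M : is_value (cs_t k P M) = is_value M.
Proof. destruct M; reflexivity. Qed.

(** Context substitution is likewise a change of environment: passing [P where x := Q] to [c l] is
    the same target term as passing [Q] to [kframe s c P (c l)]. *)
Lemma C_cs_all :
  (forall M l P s c k, C s c (cs_t l P M) k = C s (upd l (kframe s c P (c l)) c) M k) /\
  (forall J l P s c, Cj s c (cs_j l P J) = Cj s (upd l (kframe s c P (c l)) c) J).
Proof.
  apply term_jump_ind.
  - reflexivity.
  - intros M IH l P s c k. simpl. rewrite IH, kframe_ren_o, !shift_upd, !tshift_kframe.
    reflexivity.
  - intros M IHM N IHN l P s c k.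
    assert (VM : is_value M = true ->
      forall s c, cval s c (cs_t l P M) = cval s (upd l (kframe s c P (c l)) c) M).
    { intros HV s0 c0. specialize (IHM l P s0 c0 (Tv 0)).
      rewrite !C_value in IHM by (rewrite ?is_value_cs; auto). injection IHM; auto. }
    assert (VN : is_value N = true ->
      forall s c, cval s c (cs_t l P N) = cval s (upd l (kframe s c P (c l)) c) N).
    { intros HV s0 c0. specialize (IHN l P s0 c0 (Tv 0)).
      rewrite !C_value in IHN by (rewrite ?is_value_cs; auto). injection IHN; auto. }
    simpl cs_t. rewrite !C_App, !is_value_cs.
    destruct (is_value M), (is_value N); rewrite ?IHM, ?IHN, ?VM, ?VN by auto;
      rewrite ?shift_upd, ?tshift_kframe; reflexivity.
  - intros L IHL N IHN l P s c k. simpl. rewrite IHN, IHL. unfold tup.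
    rewrite kframe_ren_o, shift_upd, tshift_kframe. reflexivity.
  - intros J IH l P s c k. simpl. rewrite IH, upd_scons, kframe_ren_c. reflexivity.
  - intros m Q IH l P s c. simpl. unfold upd at 2.
    destruct (Nat.eqb_spec m l) as [-> |]; simpl; apply IH.
  - intros J IHJ N IHN l P s c. simpl. rewrite IHN, IHJ. unfold tup.
    rewrite kframe_ren_o, shift_upd, tshift_kframe. reflexivity.
Qed.

Lemma C_where_mu M J s c k :
  C s c (Mu (cs_j 0 (ren_c S M) J)) k = C s c (WhereT M (Mu J)) k.
Proof.
  simpl. rewrite (proj2 C_cs_all), upd0, kframe_ren_c. reflexivity.
Qed.

(** A literal equality: for a non-value operator the translation itself already evaluates the
    operator under a continuation that plays the role of the [where]. *)
Lemma C_app_l N M s c k : is_value N = false ->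
  C s c (WhereT (App (Var 0) (ren_o S M)) N) k = C s c (App N M) k.
Proof.
  intros HN. rewrite C_App, HN. simpl C. fold (cval (tup s) (shift c) (ren_o S M)).
  rewrite is_value_ren_o. destruct (is_value M) eqn:HM.
  - rewrite cval_ren_o, cval_tshift by auto. reflexivity.
  - rewrite C_ren_o. reflexivity.
Qed.

Lemma C_app_r V N s c k : is_value V = true -> is_value N = false ->
  C s c (WhereT (App (ren_o S V) (Var 0)) N) k = C s c (App V N) k.
Proof.
  intros HV HN. rewrite C_App, HV, HN. simpl C.
  fold (cval (tup s) (shift c) (ren_o S V)).
  rewrite is_value_ren_o, HV, cval_ren_o, cval_tshift by auto. reflexivity.
Qed.

Lemma C_where_where L M N s c k :
  C s c (WhereT (WhereT (ren_o (upren S) L) M) N) k = C s c (WhereT L (WhereT M N)) k.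
Proof.
  change (C s c N (Tk (C (tup s) (shift c) M
      (kframe (Tv 0 .: shift s) (shift c) (ren_o (upren S) L) (tshift k)))) =
    C s c N (Tk (C (tup s) (shift c) M (tshift (kframe s c L k))))).
  rewrite kframe_ren_o, tshift_kframe. reflexivity.
Qed.

Lemma C_inst M s c k w :
  inst (C (tup s) (shift c) M (tshift k)) w = C (w .: s) c M k.
Proof.
  unfold inst. rewrite C_tsub, tsub_tshift, tsub_id. unfold tup.
  rewrite sub_all_scons. f_equal.
  - f_equal. extensionality n. unfold sub_all, shift. rewrite tsub_tshift, tsub_id. reflexivity.
  - extensionality n. unfold sub_all, shift. rewrite tsub_tshift, tsub_id. reflexivity.
Qed.

Lemma C_inst2 M s c w k :
  inst2 (C (Tv 0 .: shift (shift s)) (shift (shift c)) M (Tv 1)) w k = C (w .: s) c M k.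
Proof.
  unfold inst2. rewrite C_tsub, sub_all_scons. f_equal.
  - f_equal. extensionality n. unfold sub_all, shift.
    rewrite !tsub_tshift, tsub_id. reflexivity.
  - extensionality n. unfold sub_all, shift. rewrite !tsub_tshift, tsub_id. reflexivity.
Qed.

Lemma Cj_inst J s c w :
  inst (Cj (tup s) (shift c) J) w = Cj (w .: s) c J.
Proof.
  unfold inst. rewrite (proj2 C_tsub_all). unfold tup. rewrite sub_all_scons. f_equal.
  - f_equal. extensionality n. unfold sub_all, shift. rewrite tsub_tshift, tsub_id. reflexivity.
  - extensionality n. unfold sub_all, shift. rewrite tsub_tshift, tsub_id. reflexivity.
Qed.

(** * Realizability *)

(** The folds stand for quantification over members, in a form accepted as structural recursion;
    [vint_Arr] is the readable version. Continuations are interpreted by orthogonality to the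
    pole. *)
Fixpoint vint (pole atm : tm -> Prop) (r : raw) (v : tm) : Prop :=
  match r with
  | Atom _ => atm v
  | Arr s T => forall w k,
      fold_right (fun r P => vint pole atm r w /\ P) True s ->
      fold_right (fun s' P => (forall w', fold_right (fun r P => vint pole atm r w' /\ P) True s' ->
        pole (Th k w')) /\ P) True T ->
      pole (Ta v w k)
  end.

Definition sint (pole atm : tm -> Prop) (s : sub) (w : tm) : Prop :=
  forall r, In r s -> vint pole atm r w.
Definition kint (pole atm : tm -> Prop) (T : ty) (k : tm) : Prop :=
  forall s, In s T -> forall w, sint pole atm s w -> pole (Th k w).

Lemma fold_right_and {A} (P : A -> Prop) l :
  fold_right (fun a Q => P a /\ Q) True l <-> forall a, In a l -> P a.
Proof.
  induction l as [| a l IH]; simpl.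
  - split; auto. intros _ a [].
  - rewrite IH. split.
    + intros [H1 H2] b [<- | Hb]; auto.
    + intros H; split; auto.
Qed.

Lemma vint_Arr pole atm s T v : vint pole atm (Arr s T) v <->
  forall w k, sint pole atm s w -> kint pole atm T k -> pole (Ta v w k).
Proof.
  simpl. split; intros H w k H1 H2; apply H.
  - apply (fold_right_and (fun r => vint pole atm r w)); auto.
  - apply (fold_right_and (fun s' => forall w', _ -> pole (Th k w'))).
    intros s' Hs' w' Hw'. apply (H2 s' Hs').
    exact (proj1 (fold_right_and (fun r => vint pole atm r w') s') Hw').
  - exact (proj1 (fold_right_and (fun r => vint pole atm r w) s) H1).
  - intros s' Hs' w' Hw'.
    apply (proj1 (fold_right_and (fun s' => forall w', _ -> pole (Th k w')) T) H2 s' Hs' w').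
    apply (fold_right_and (fun r => vint pole atm r w')); auto.
Qed.

Lemma vint_rle pole atm r : forall r',
  (rle r r' -> forall v, vint pole atm r v -> vint pole atm r' v) /\
  (rle r' r -> forall v, vint pole atm r' v -> vint pole atm r v).
Proof.
  induction r as [a | s T IHS IHT] using raw_nested_ind; intros r'; split; intros H;
    inversion H as [| S1 S2 T1 T2 A B]; subst; auto; intros v Hv;
    rewrite vint_Arr in *; intros w k Hw Hk; apply Hv.
  - intros r Hr. destruct (A r Hr) as (r' & Hr' & L).
    apply (proj2 (IHS r Hr r')); auto.
  - intros u Hu w' Hw'. destruct (B u Hu) as (u' & Hu' & L).
    apply (Hk u' Hu'). intros r' Hr'. destruct (L r' Hr') as (r & Hr & L').
    apply (proj1 (IHT u Hu r Hr r')); auto.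
  - intros r Hr. destruct (A r Hr) as (r' & Hr' & L).
    apply (proj1 (IHS r' Hr' r)); auto.
  - intros u Hu w' Hw'. destruct (B u Hu) as (u' & Hu' & L).
    apply (Hk u' Hu'). intros r' Hr'. destruct (L r' Hr') as (r & Hr & L').
    apply (proj2 (IHT u' Hu' r' Hr' r)); auto.
Qed.

Lemma sint_sle pole atm s s' w : sle s s' -> sint pole atm s w -> sint pole atm s' w.
Proof.
  intros L H r' Hr'. destruct (L r' Hr') as (r & Hr & L').
  apply (proj1 (vint_rle pole atm r r')); auto.
Qed.

Definition saturated (pole : tm -> Prop) : Prop :=
  (forall t w, pole (inst t w) -> pole (Th (Tk t) w)) /\
  (forall t w k, pole (inst2 t w k) -> pole (Ta (Tl t) w k)).

(** The second conjunct, for values, is needed because the translation of an application inserts a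
    value directly, without passing it to a continuation. *)
Lemma adequacy pole atm : saturated pole ->
  (forall M G D T s c, den G D M T ->
     (forall x, sint pole atm (G x) (s x)) -> (forall l, kint pole atm (D l) (c l)) ->
     (forall k, kint pole atm T k -> pole (C s c M k)) /\
     (is_value M = true -> exists u, In u T /\ sint pole atm u (cval s c M))) /\
  (forall J G D s c, denj G D J ->
     (forall x, sint pole atm (G x) (s x)) -> (forall l, kint pole atm (D l) (c l)) ->
     pole (Cj s c J)).
Proof.
  intros [P1 P2].
  assert (EG : forall u w G s, sint pole atm u w -> (forall x, sint pole atm (G x) (s x)) ->
    forall x, sint pole atm ((u .: G) x) ((w .: s) x)).
  { intros u w G s H1 H2 [| x]; simpl; auto. }
  assert (ED : forall T k D c, kint pole atm T k -> (forall l, kint pole atm (D l) (c l)) ->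
    forall l, kint pole atm ((T .: D) l) ((k .: c) l)).
  { intros T k D c H1 H2 [| x]; simpl; auto. }
  assert (VK : forall s c V T, is_value V = true ->
    (exists u, In u T /\ sint pole atm u (cval s c V)) ->
    forall k, kint pole atm T k -> pole (C s c V k)).
  { intros s c V T HV (u & Hu & H) k Hk. rewrite C_value by auto. apply (Hk u Hu); auto. }
  apply term_jump_ind.
  - intros x G D T s c (u & Hu & L) HG HD.
    assert (K : exists u, In u T /\ sint pole atm u (cval s c (Var x))).
    { exists u; split; auto. apply (sint_sle pole atm _ _ _ L). apply HG. }
    split; auto. apply VK; auto.
  - intros M IH G D T s c (u & Hu & L) HG HD.
    assert (K : exists u, In u T /\ sint pole atm u (cval s c (Lam M))).
    { exists u; split; auto. intros r Hr. destruct (L r Hr) as (S1 & T1 & -> & H).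
      apply vint_Arr. intros w k Hw Hk. apply P2. rewrite C_inst2.
      apply (IH _ _ _ _ _ H); auto. }
    split; auto. apply VK; auto.
  - intros M IHM N IHN G D T s c (As & H1 & H2) HG HD. split; [| discriminate].
    intros k Hk.
    (* The argument is treated once for an arbitrary realizer [v] of the operator type; [v] is the
       operator itself or the result of evaluating it. *)
    assert (B : forall A v, In A As -> sint pole atm A v ->
      pole (if is_value N then Ta v (cval s c N) k
            else C s c N (Tk (Ta (tshift v) (Tv 0) (tshift k))))).
    { intros A v HA Hv. destruct (H2 A HA) as (Us & H3 & H4).
      assert (HU : forall U w, In U Us -> sint pole atm U w -> pole (Ta v w k)).
      { intros U w HU Hw.
        apply (sint_sle pole atm _ _ _ (H4 U HU)) in Hv.
        specialize (Hv _ (or_introl eq_refl)). rewrite vint_Arr in Hv. auto. }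
      destruct (IHN _ _ _ _ _ H3 HG HD) as [A1 A2].
      destruct (is_value N) eqn:HN.
      - destruct (A2 eq_refl) as (U & ? & ?). eauto.
      - apply A1. intros U HU' w Hw. apply P1. unfold inst. simpl.
        rewrite !tsub_tshift, !tsub_id. eauto. }
    destruct (IHM _ _ _ _ _ H1 HG HD) as [A1 A2].
    destruct (is_value M) eqn:HM.
    + destruct (A2 eq_refl) as (A & HA & Hv). rewrite C_App, HM. eauto.
    (* Naming the operator does not change the translation, and after instantiation the operator is
       a variable, which is a value. *)
    + rewrite <- C_app_l by auto. simpl C. apply A1. intros A HA w Hw. apply P1.
      change (pole (inst (C (tup s) (shift c) (App (Var 0) (ren_o S N)) (tshift k)) w)).
      rewrite C_inst, C_App. change (is_value (Var 0)) with true. cbv iota.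
      rewrite is_value_ren_o, C_ren_o. destruct (is_value N) eqn:HN.
      * rewrite cval_ren_o by auto. apply (B A w); auto.
      * apply (B A w); auto.
  - intros L IHL N IHN G D T s c (Ss & H1 & H2) HG HD. split; [| discriminate].
    intros k Hk. simpl. apply (IHN _ _ _ _ _ H1 HG HD). intros u Hu w Hw. apply P1.
    rewrite C_inst. apply (IHL _ _ _ (w .: s) c (H2 u Hu)); auto.
  - intros J IH G D T s c H HG HD. split; [| discriminate]. intros k Hk. simpl.
    eapply IH; [exact H | |]; auto.
  - intros l M IH G D s c H HG HD. simpl. apply (IH _ _ _ _ _ H); auto.
  - intros J IHJ N IHN G D s c (Ss & H1 & H2) HG HD.
    simpl. apply (IHN _ _ _ _ _ H1 HG HD). intros u Hu w Hw. apply P1.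
    rewrite Cj_inst. apply (IHJ _ _ (w .: s) c (H2 u Hu)); auto.
Qed.

(** The index bounds the number of root steps taken before a variable comes to the head; it need not
    be exact. *)
Inductive halts : nat -> tm -> Prop :=
| halts_Th n k w : halts n (Th (Tv k) w)
| halts_Ta n v w k : halts n (Ta (Tv v) w k)
| halts_Tk n t w : halts n (inst t w) -> halts (S n) (Th (Tk t) w)
| halts_Tl n t w k : halts n (inst2 t w k) -> halts (S n) (Ta (Tl t) w k).

(** With halting as pole a target variable realizes every type and every continuation type, as
    anything headed by a variable halts at once; omega and mho cause no trouble. *)
Lemma typable_halts M : typable M -> exists n, halts n (C Tv Tv M (Tv 0)).
Proof.
  intros (G & D & T & H).
  assert (HS : saturated (fun t => exists n, halts n t)).
  { split; intros * [n Hn]; exists (S n); constructor; auto. }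
  assert (HV : forall r x, vint (fun t => exists n, halts n t) (fun _ => True) r (Tv x)).
  { intros [a | s T'] x; [exact I |]. apply vint_Arr. intros. exists 0. constructor. }
  assert (HK : forall T' x, kint (fun t => exists n, halts n t) (fun _ => True) T' (Tv x)).
  { intros T' x s Hs w Hw. exists 0. constructor. }
  apply (proj1 (adequacy _ (fun _ => True) HS) M G D T Tv Tv H); auto.
  intros x r Hr; auto.
Qed.

(** The root redex is always contracted and its parts are not inspected, so saturation holds by the
    last two constructors. *)
Inductive wn : tm -> Prop :=
| wn_Tv n : wn (Tv n)
| wn_Tl t : wn t -> wn (Tl t)
| wn_Tk t : wn t -> wn (Tk t)
| wn_Th_var n w : wn w -> wn (Th (Tv n) w)
| wn_Ta_var n w k : wn w -> wn k -> wn (Ta (Tv n) w k)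
| wn_Th_step t w : wn (inst t w) -> wn (Th (Tk t) w)
| wn_Ta_step t w k : wn (inst2 t w k) -> wn (Ta (Tl t) w k).

Lemma tren_inst xi t w : tren xi (inst t w) = inst (tren (upren xi) t) (tren xi w).
Proof.
  unfold inst. rewrite tren_tsub_comp, tsub_tren. f_equal.
  extensionality n. destruct n; reflexivity.
Qed.

Lemma tren_inst2 xi t w k :
  tren xi (inst2 t w k) = inst2 (tren (upren (upren xi)) t) (tren xi w) (tren xi k).
Proof.
  unfold inst2. rewrite tren_tsub_comp, tsub_tren. f_equal.
  extensionality n. destruct n as [| [|]]; reflexivity.
Qed.

(** Renaming creates no redex and commutes with [inst] and [inst2], so each rule used after the
    renaming was available before it. *)
Lemma wn_tren_inv t : wn t -> forall xi t0, t = tren xi t0 -> wn t0.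
Proof.
  induction 1; intros xi [m | t0 | t0 | k0 w0 | v0 w0 k0] E; simpl in E;
    try discriminate; injection E; intros; subst; try (constructor; eauto; fail).
  - destruct k0; try discriminate. constructor; eauto.
  - destruct v0; try discriminate. constructor; eauto.
  - destruct k0 as [| | t0 | |]; try discriminate. simpl in *.
    match goal with E' : Tk _ = Tk _ |- _ => injection E' as -> end. constructor.
    apply (IHwn xi). rewrite tren_inst. reflexivity.
  - destruct v0 as [| t0 | | |]; try discriminate. simpl in *.
    match goal with E' : Tl _ = Tl _ |- _ => injection E' as -> end. constructor.
    apply (IHwn xi). rewrite tren_inst2. reflexivity.
Qed.

Lemma inst_var t x : inst t (Tv x) = tren (x .: (fun n => n)) t.
Proof.
  unfold inst. rewrite tren_tsub. f_equal. extensionality n. destruct n; reflexivity.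
Qed.

Lemma inst2_var t x y : inst2 t (Tv x) (Tv y) = tren (x .: y .: (fun n => n)) t.
Proof.
  unfold inst2. rewrite tren_tsub. f_equal. extensionality n. destruct n as [| [|]]; reflexivity.
Qed.

(* A realizer of a good arrow type is normalizing because it may be applied to
   variables, and instantiating variables by variables reflects [wn]. *)
Lemma vint_wn r : raw_bad r = false ->
  (forall x, vint wn wn r (Tv x)) /\ (forall v, vint wn wn r v -> wn v).
Proof.
  induction r as [a | s T IHS IHT] using raw_nested_ind; intros HB.
  - split; [constructor | auto].
  - apply raw_bad_Arr in HB. destruct HB as [HS HT].
    rewrite sgood_iff in HS. rewrite tgood_iff in HT.
    destruct HS as [NS HS], HT as [NT HT].
    assert (HT' : forall u, In u T -> u <> [] /\ forall r, In r u -> raw_bad r = false).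
    { intros u Hu. apply sgood_iff. auto. }
    assert (SV : forall x, sint wn wn s (Tv x)). { intros x r Hr. apply IHS; auto. }
    assert (SW : forall w, sint wn wn s w -> wn w).
    { intros w Hw. destruct s as [| r s]; [congruence |].
      apply (proj2 (IHS r (or_introl eq_refl) (HS _ (or_introl eq_refl)))).
      apply Hw; simpl; auto. }
    assert (TK : forall x, kint wn wn T (Tv x)).
    { intros x u Hu w Hw. constructor. destruct (HT' u Hu) as [NU HU].
      destruct u as [| r u]; [congruence |].
      apply (proj2 (IHT _ Hu r (or_introl eq_refl) (HU _ (or_introl eq_refl)))).
      apply Hw; simpl; auto. }
    assert (TW : forall k, kint wn wn T k -> wn k).
    { intros k Hk. destruct T as [| u T]; [congruence |].
      assert (Hu : In u (u :: T)) by (simpl; auto).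
      assert (H : wn (Th k (Tv 0))).
      { apply (Hk u Hu). intros r Hr. apply (IHT u Hu r Hr). apply (HT' u Hu); auto. }
      inversion H; subst; constructor.
      rewrite inst_var in *. eapply wn_tren_inv; eauto. }
    split.
    + intros x. apply vint_Arr. intros w k Hw Hk. constructor; auto.
    + intros v Hv. rewrite vint_Arr in Hv. specialize (Hv _ _ (SV 0) (TK 0)).
      inversion Hv; subst; constructor.
      rewrite inst2_var in *. eapply wn_tren_inv; eauto.
Qed.

Lemma good_typable_wn M : good_typable M -> wn (C Tv Tv M (Tv 0)).
Proof.
  intros (G & D & T & H & HG & HD & HT).
  assert (HS : saturated wn). { split; constructor; auto. }
  assert (HV : forall s x, sgood s -> sint wn wn s (Tv x)).
  { intros s x Hs r Hr. apply sgood_iff in Hs. apply vint_wn. apply Hs; auto. }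
  assert (HK : forall T' x, tgood T' -> kint wn wn T' (Tv x)).
  { intros T' x HT' s Hs w Hw. constructor. apply tgood_iff in HT'.
    apply HT', sgood_iff in Hs. destruct Hs as [Hn Hs]. destruct s as [| r s]; [congruence |].
    apply (vint_wn r); [apply Hs | apply Hw]; simpl; auto. }
  apply (proj1 (adequacy _ wn HS) M G D T Tv Tv H); auto.
Qed.

(** * Typability implies termination of evaluation *)

(* [rk] counts the [Mu]s met on the way to the active subterm and [fr] weighs the
   frames above the first of them.  Steps that leave the translation unchanged
   decrease [(rk, fr)] lexicographically. *)
Fixpoint rk (M : term) : nat :=
  match M with
  | Var _ | Lam _ => 0
  | App M N => if is_value M then rk N else rk M
  | WhereT _ N => rk N
  | Mu J => S (rkj J)
  end
with rkj (J : jump) : nat :=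
  match J with Jmp _ M => rk M | WhereJ _ N => rk N end.

Fixpoint fr (M : term) : nat :=
  match M with
  | Var _ | Lam _ | Mu _ => 0
  | App M N => 2 + if is_value M then fr N else fr M
  | WhereT _ N => 1 + fr N
  end.

Lemma rk_ren_c : (forall M xi, rk (ren_c xi M) = rk M) /\
  (forall J xi, rkj (ren_cj xi J) = rkj J).
Proof.
  apply term_jump_ind; simpl; intros; rewrite ?is_value_ren_c, ?H, ?H0; auto.
Qed.

Lemma rk_cs : (forall M k P, rk (cs_t k P M) = rk M) /\
  (forall J k P, rkj (cs_j k P J) = rkj J).
Proof.
  apply term_jump_ind; simpl; intros; rewrite ?is_value_cs, ?H, ?H0; auto.
  destruct (n =? k); simpl; auto.
Qed.

Lemma e0_step_nonvalue M M' : e0_step M M' -> is_value M = false.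
Proof. destruct 1; reflexivity. Qed.

Lemma C_app_head V N s c k : is_value V = true ->
  C (cval s c V .: s) c (App (Var 0) (ren_o S N)) k = C s c (App V N) k.
Proof.
  intros HV. rewrite !C_App, HV, is_value_ren_o. change (is_value (Var 0)) with true.
  cbv iota. rewrite C_ren_o. destruct (is_value N) eqn:HN; auto.
  rewrite cval_ren_o by auto. reflexivity.
Qed.

Lemma C_app_arg V W s c k : is_value V = true -> is_value W = true ->
  C (cval s c W .: s) c (App (ren_o S V) (Var 0)) k = C s c (App V W) k.
Proof.
  intros HV HW. rewrite !C_App, HV, HW, is_value_ren_o, HV, cval_ren_o by auto. reflexivity.
Qed.

Lemma halts_where_val n s c L V k : is_value V = true ->
  halts n (C s c (WhereT L V) k) ->
  exists m, m < n /\ halts m (C (cval s c V .: s) c L k).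
Proof.
  intros HV H. simpl in H. rewrite C_value in H by auto. inversion H; subst.
  rewrite C_inst in *. eauto.
Qed.

(** The first alternative also covers [E0_beta]: both sides make one target step to the same term,
    and [fr] drops because it weighs an application 2 and a [where] 1. That [L'] is not a value
    keeps [rk] and [fr] following the same path inside a context. *)
Lemma e0_step_sim L L' : e0_step L L' ->
  (is_value L' = false /\ rk L' = rk L /\ fr L' < fr L /\
   forall s c k n, halts n (C s c L k) -> halts n (C s c L' k)) \/
  (forall s c k n, halts n (C s c L k) -> exists m, m < n /\ halts m (C s c L' k)).
Proof.
  induction 1.
  - left. repeat split; auto. intros. rewrite C_app_l; auto.
  - left. repeat split; auto.
    + simpl. rewrite H. reflexivity.
    + simpl. rewrite H. auto.
    + intros. rewrite C_app_r; auto.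
  - left. repeat split; auto.
    intros s c k n Hn. rewrite C_App, H in Hn. inversion Hn; subst.
    rewrite C_inst2 in *. simpl. rewrite C_value by auto. constructor.
    rewrite C_inst. auto.
  - right. intros s c k n Hn. rewrite C_subst1 by auto. apply halts_where_val; auto.
  - left. repeat split; auto.
    + simpl. rewrite (proj2 rk_cs). reflexivity.
    + intros. rewrite C_where_mu; auto.
  - assert (HM := e0_step_nonvalue _ _ H).
    destruct IHe0_step as [(A1 & A2 & A3 & A4) | A].
    + left. simpl. rewrite HM, A1. repeat split; auto; lia.
    (* An operator context is seen as a [where] frame, so that the induction hypothesis applies to
       the operator with a suitable continuation. *)
    + right. intros s c k n Hn. rewrite <- C_app_l in Hn by auto. simpl in Hn.
      apply A in Hn. destruct Hn as (m & Hm & Hn).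
      change (halts m (C s c (WhereT (App (Var 0) (ren_o S N)) M') k)) in Hn.
      (* If the operator has become a value, the frame fires as well and the bound drops once
         more. *)
      destruct (is_value M') eqn:HM'.
      * apply halts_where_val in Hn; auto. destruct Hn as (m' & ? & Hn).
        rewrite C_app_head in Hn by auto. exists m'; split; auto; lia.
      * rewrite C_app_l in Hn by auto. eauto.
  - assert (HN := e0_step_nonvalue _ _ H0).
    destruct IHe0_step as [(A1 & A2 & A3 & A4) | A].
    + left. simpl. rewrite H, HN, A1. repeat split; auto; lia.
    + right. intros s c k n Hn. rewrite <- C_app_r in Hn by auto. simpl in Hn.
      apply A in Hn. destruct Hn as (m & Hm & Hn).
      change (halts m (C s c (WhereT (App (ren_o S V) (Var 0)) N') k)) in Hn.
      destruct (is_value N') eqn:HN'.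
      * apply halts_where_val in Hn; auto. destruct Hn as (m' & ? & Hn).
        rewrite C_app_arg in Hn by auto. exists m'; split; auto; lia.
      * rewrite C_app_r in Hn by auto. eauto.
  - destruct IHe0_step as [(A1 & A2 & A3 & A4) | A].
    + left. simpl. repeat split; auto; try lia.
    + right. intros s c k n Hn. simpl in *. auto.
Qed.

Definition evaluates (M : term) : Prop :=
  exists N, clos_refl_trans term e_step M N /\ ~ (exists N', e_step N N').

Lemma evaluates_step M M' : e_step M M' -> evaluates M' -> evaluates M.
Proof.
  intros H (N & H1 & H2). exists N; split; auto.
  eapply rt_trans; [apply rt_step, H | exact H1].
Qed.

Lemma evaluates_stuck M : ~ (exists M', e_step M M') -> evaluates M.
Proof. intros H. exists M; split; auto using rt_refl. Qed.

(** Non-canonical jumps evaluate trivially, which spares the two inductions below a canonicity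
    hypothesis. *)
Lemma evaluates_WhereJ J N : evaluates (Mu (WhereJ J N)).
Proof. apply evaluates_stuck. intros [M' H]. inversion H; subst. inversion H0. Qed.

Lemma is_mu_dec M : {J | M = Mu J} + {forall J, M <> Mu J}.
Proof. destruct M; try (right; congruence). left; eauto. Qed.

(** Lexicographic induction on [(n, rk, fr)]: target steps lower [n], merging two [Mu] lowers [rk],
    and the remaining steps lower [fr] at constant [rk]. *)
Lemma halts_evaluates_Mu n : forall r f l L s c, rk L <= r -> fr L <= f ->
  halts n (C s c L (c l)) -> evaluates (Mu (Jmp l L)).
Proof.
  induction n as [n IHn] using lt_wf_ind.
  induction r as [r IHr] using lt_wf_ind.
  induction f as [f IHf] using lt_wf_ind.
  intros l L s c Hr Hf H.
  destruct (is_mu_dec L) as [[J ->] | HJ].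
  (* The inner [Mu] binds its continuation to [c l], which is what renaming by [csub1 l] does; the
     translation and its bound stay the same. *)
  - eapply evaluates_step; [apply E_mu_mu |]. simpl in H.
    rewrite <- csub1_scons in H. rewrite <- (proj2 C_ren_c_all) in H.
    assert (HR : rkj (ren_cj (csub1 l) J) < r).
    { rewrite (proj2 rk_ren_c). simpl in Hr. lia. }
    destruct (ren_cj (csub1 l) J) as [l' L' | J' N']; [| apply evaluates_WhereJ].
    eapply (IHr (rk L')); [exact HR | auto | apply le_n | exact H].
  - destruct (classic (exists L', e0_step L L')) as [[L' HL] | HL].
    + eapply evaluates_step; [apply E_under, HL |].
      destruct (e0_step_sim _ _ HL) as [(_ & A2 & A3 & A4) | A].
      * eapply (IHf (fr L')); [lia | lia | auto | apply A4, H].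
      * apply A in H. destruct H as (m & Hm & H).
        eapply (IHn m Hm); [apply le_n | apply le_n | exact H].
    + apply evaluates_stuck. intros [M' HM]. inversion HM; subst.
      * eapply HJ; reflexivity.
      * inversion H0.
      * eauto.
Qed.

(** Above the first [Mu] no merging can happen, so [fr] suffices beside [n]; when a [Mu] reaches the
    root the previous lemma takes over. *)
Lemma halts_evaluates n : forall f M s c k, fr M <= f ->
  halts n (C s c M k) -> evaluates M.
Proof.
  induction n as [n IHn] using lt_wf_ind.
  induction f as [f IHf] using lt_wf_ind.
  intros M s c k Hf H.
  destruct (is_mu_dec M) as [[[l L | J N] ->] | HJ].
  - eapply halts_evaluates_Mu; [apply le_n | apply le_n | exact H].
  - apply evaluates_WhereJ.
  - destruct (classic (exists L', e0_step M L')) as [[L' HL] | HL].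
    + eapply evaluates_step; [apply E_e0, HL |].
      destruct (e0_step_sim _ _ HL) as [(_ & A2 & A3 & A4) | A].
      * eapply (IHf (fr L')); [lia | auto | apply A4, H].
      * apply A in H. destruct H as (m & Hm & H).
        eapply (IHn m Hm); [apply le_n | exact H].
    + apply evaluates_stuck. intros [M' HM]. inversion HM; subst; eauto;
        eapply HJ; reflexivity.
Qed.

Lemma typable_cbv_terminates M : typable M -> cbv_terminates M.
Proof.
  intros (G & D & T & H).
  assert (H' : typable (e3_t M)).
  { exists G, D, T. apply (den_equiv M (e3_t M)); auto. apply e3_equiv. }
  apply typable_halts in H'. destruct H' as (n & Hn).
  eapply halts_evaluates; [apply le_n | exact Hn].
Qed.

(** * Good typability implies normalizability *)

(** [wn] with a bound on the height of the derivation, a number that can head a lexicographic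
    measure and that also drops when passing to subterms. *)
Inductive wnh : nat -> tm -> Prop :=
| wnh_Tv n x : wnh n (Tv x)
| wnh_Tl n t : wnh n t -> wnh (S n) (Tl t)
| wnh_Tk n t : wnh n t -> wnh (S n) (Tk t)
| wnh_Th_var n x w : wnh n w -> wnh (S n) (Th (Tv x) w)
| wnh_Ta_var n x w k : wnh n w -> wnh n k -> wnh (S n) (Ta (Tv x) w k)
| wnh_Th_step n t w : wnh n (inst t w) -> wnh (S n) (Th (Tk t) w)
| wnh_Ta_step n t w k : wnh n (inst2 t w k) -> wnh (S n) (Ta (Tl t) w k).

Lemma wnh_mono n t : wnh n t -> forall m, n <= m -> wnh m t.
Proof.
  induction 1; intros m Hm; [constructor | ..]; (destruct m; [lia |]); constructor;
    try apply IHwnh; try apply IHwnh1; try apply IHwnh2; lia.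
Qed.

Lemma wn_wnh t : wn t -> exists n, wnh n t.
Proof.
  induction 1;
    try (destruct IHwn as [m Hm]; exists (S m); constructor; assumption).
  - exists 0; constructor.
  - destruct IHwn1 as [m1 H1], IHwn2 as [m2 H2]. exists (S (max m1 m2)).
    constructor; eapply wnh_mono; eauto; lia.
Qed.

Definition rr : term -> term -> Prop :=
  clos_refl_trans term (fun M N => step_t M N \/ tm_equiv M N).

Lemma rr_step M N : step_t M N -> rr M N.
Proof. intros; apply rt_step; auto. Qed.

Lemma rr_equiv M N : tm_equiv M N -> rr M N.
Proof. intros; apply rt_step; auto. Qed.

Lemma rr_trans M N P : rr M N -> rr N P -> rr M P.
Proof. apply rt_trans. Qed.

Lemma rr_lam M M' : rr M M' -> rr (Lam M) (Lam M').
Proof. apply clos_rt_map.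
  intros x y [H | H]; [left; constructor | right; apply equiv_lam]; auto. Qed.

Lemma rr_appr M N N' : rr N N' -> rr (App M N) (App M N').
Proof. apply clos_rt_map.
  intros x y [H | H]; [left; constructor | right; apply equiv_appr]; auto. Qed.

Lemma rr_wherel L L' N : rr L L' -> rr (WhereT L N) (WhereT L' N).
Proof.
  apply (clos_rt_map _ _ (fun L => WhereT L N)).
  intros x y [H | H]; [left; constructor | right; apply equiv_wherel]; auto.
Qed.

Lemma rr_wherer L N N' : rr N N' -> rr (WhereT L N) (WhereT L N').
Proof. apply clos_rt_map.
  intros x y [H | H]; [left; constructor | right; apply equiv_wherer]; auto. Qed.

Lemma rr_mu_jmp l M M' : rr M M' -> rr (Mu (Jmp l M)) (Mu (Jmp l M')).
Proof.
  apply (clos_rt_map _ _ (fun M => Mu (Jmp l M))).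
  intros x y [H | H]; [left; repeat constructor | right; apply equiv_mu, equiv_jmp]; auto.
Qed.

(** Congruence steps are absorbed by the next [red1] step; those with none after them remain at the
    end. *)
Lemma rr_red1 M N : rr M N ->
  exists N', clos_refl_trans term red1 M N' /\ tm_equiv N' N.
Proof.
  intros H. apply clos_rt_rt1n in H. induction H as [M | M M1 N [H | H] _ IH].
  - exists M; split; [apply rt_refl | apply rst_refl].
  - destruct IH as (N' & H1 & H2). exists N'; split; auto.
    eapply rt_trans; [apply rt_step | exact H1].
    exists M, M1; repeat split; auto; apply rst_refl.
  - destruct IH as (N' & H1 & H2). apply clos_rt_rt1n in H1.
    destruct H1 as [| X N' (P & Q & A1 & A2 & A3) H1].
    + exists M; split; [apply rt_refl | eapply rst_trans; eauto].
    + exists N'; split; auto. apply clos_rt1n_rt in H1.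
      eapply rt_trans; [apply rt_step | exact H1].
      exists P, Q; repeat split; auto. eapply rst_trans; eauto.
Qed.

Definition nrm (M : term) : Prop := exists M', rr M M' /\ nf M'.

Lemma nrm_rr M N : rr M N -> nrm N -> nrm M.
Proof. intros H (P & H1 & H2). exists P; split; auto. eapply rr_trans; eauto. Qed.

Lemma nrm_normalizable M : nrm M -> normalizable M.
Proof.
  intros (P & H1 & H2). apply rr_red1 in H1. destruct H1 as (N & H1 & H3).
  apply nf_equiv in H3. destruct (nf_normalizable (S (size N)) N) as (Q & A & B);
    [lia | tauto |].
  exists Q; split; auto. eapply rt_trans; eauto.
Qed.

Lemma tail_mu_equiv M : tail M = KMu -> exists J, tm_equiv M (Mu J).
Proof.
  induction M; simpl; intros H; try discriminate.
  - destruct (IHM1 H) as (J & HJ). eexists.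
    eapply rst_trans; [apply equiv_wherel, HJ | apply rst_step, E2].
  - eexists; apply rst_refl.
Qed.

(** A normal body may still end in a [Mu]. (E2) brings that [Mu] to the root of the body, one
    contraction merges it with the jump, and the renaming involved preserves normality. *)
Lemma nrm_mu J : nrm (flat_body J) -> nrm (Mu J).
Proof.
  intros (L & H1 & H2).
  eapply nrm_rr; [apply rr_equiv, equiv_mu, flat_equiv |].
  eapply nrm_rr; [apply rr_mu_jmp, H1 |].
  destruct (tail_eq_dec (tail L) KMu) as [HT | HT].
  - destruct (tail_mu_equiv L HT) as (J' & HJ').
    eapply nrm_rr; [apply rr_equiv, equiv_mu, equiv_jmp, HJ' |].
    eapply nrm_rr; [apply rr_step, S_mu, R_jmp_mu |].
    eexists; split; [apply rt_refl |]. simpl. apply nf_ren_c.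
    apply nf_equiv in HJ'. apply HJ' in H2. exact H2.
  - eexists; split; [apply rt_refl |]. simpl; auto.
Qed.

Lemma Cj_flat J : forall s c, Cj s c J = C s c (flat_body J) (c (flat_label J)).
Proof. induction J as [l L | J IH N]; intros s c; simpl; [| rewrite IH]; reflexivity. Qed.

Lemma rk_flat J : rk (flat_body J) = rkj J.
Proof. destruct J; reflexivity. Qed.

Definition is_ren (s : nat -> tm) : Prop := forall x, exists n, s x = Tv n.

Lemma is_ren_shift s : is_ren s -> is_ren (shift s).
Proof. intros H x. destruct (H x) as [n E]. unfold shift. rewrite E. exists (S n); reflexivity. Qed.

Lemma is_ren_scons x s : is_ren s -> is_ren (Tv x .: s).
Proof. intros H [| y]; simpl; eauto. Qed.

(** The derivation for the translation guides the source: a target redex prescribes source steps,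
    and a variable at the head yields derivations for the parts. Environments stay renamings, so a
    source variable in operator position is a variable in the target. The measure is again
    [(n, rk, fr)]. *)
Lemma wnh_nrm n : forall r f L s c x, is_ren s -> is_ren c -> rk L <= r -> fr L <= f ->
  wnh n (C s c L (Tv x)) -> nrm L.
Proof.
  induction n as [n IHn] using lt_wf_ind.
  induction r as [r IHr] using lt_wf_ind.
  induction f as [f IHf] using lt_wf_ind.
  intros L s c x Hs Hc Hr Hf H.
  (* Three ways to proceed: [real] after the height has dropped, [admin] when the translation is
     unchanged, and [value] for values standing as arguments, whose normal forms must again be
     values. *)
  assert (real : forall m M s c x, m < n -> is_ren s -> is_ren c ->
    wnh m (C s c M (Tv x)) -> nrm M).
  { intros m M s0 c0 x0 Hm Hs0 Hc0 HW.
    exact (IHn m Hm (rk M) (fr M) M s0 c0 x0 Hs0 Hc0 (le_n _) (le_n _) HW). }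
  assert (admin : forall M, rk M <= rk L -> fr M < fr L -> rr L M ->
    C s c M (Tv x) = C s c L (Tv x) -> nrm L).
  { intros M H1 H2 H3 H4. eapply nrm_rr; [exact H3 |].
    eapply (IHf (fr M)); [lia | exact Hs | exact Hc | lia | apply le_n |].
    rewrite H4. exact H. }
  assert (value : forall m V, m < n -> is_value V = true -> wnh m (cval s c V) ->
    exists V', rr V V' /\ nf V' /\ is_value V' = true).
  { intros m V Hm HV HW. destruct V as [y | M | | |]; try discriminate.
    - exists (Var y); repeat split. apply rt_refl.
    - inversion HW as [| m' t HW' | | | | |]; subst.
      assert (nrm M) as (M' & ? & ?).
      { eapply (real m'); [lia | | | exact HW'];
          auto using is_ren_scons, is_ren_shift. }
      exists (Lam M'); repeat split; auto using rr_lam. }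
  destruct L as [y | M | M N | L N | J].
  - exists (Var y); split; [apply rt_refl | exact I].
  - rewrite C_value in H by auto. inversion H; subst.
    destruct (value n0 (Lam M)) as (V' & ? & ? & _); auto. exists V'; auto.
  - destruct (is_value M) eqn:HM.
    2:{ apply (admin (WhereT (App (Var 0) (ren_o S N)) M)).
        - simpl. rewrite HM. auto.
        - simpl. rewrite HM. auto.
        - apply rr_step, R_app_l; auto.
        - apply C_app_l; auto. }
    destruct (is_value N) eqn:HN.
    2:{ apply (admin (WhereT (App (ren_o S M) (Var 0)) N)).
        - simpl. rewrite HM. auto.
        - simpl. rewrite HM. auto.
        - apply rr_step, R_app_r; auto.
        - apply C_app_r; auto. }
    rewrite C_App, HM, HN in H. destruct M as [y | M | | |]; try discriminate.
    + simpl in H. destruct (Hs y) as [z E]. rewrite E in H. inversion H; subst.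
      destruct (value n0 N) as (V' & ? & ? & ?); auto.
      exists (App (Var y) V'); split; [apply rr_appr; auto |]. simpl; auto.
    + simpl in H. inversion H; subst. rewrite C_inst2, <- C_subst1 in * by auto.
      eapply nrm_rr; [apply rr_step, R_beta; auto |].
      eapply nrm_rr; [apply rr_step, R_where_val; auto |].
      apply (real n0 _ s c x); auto.
  - destruct (is_value N) eqn:HN.
    { simpl in H. rewrite C_value in H by auto. inversion H; subst.
      rewrite C_inst in *. rewrite <- C_subst1 in * by auto.
      eapply nrm_rr; [apply rr_step, R_where_val; auto |].
      apply (real n0 _ s c x); auto. }
    destruct N as [y | M | A B | M N | J]; try discriminate.
    + change (wnh n (C s c (App A B) (kframe s c L (Tv x)))) in H.
      destruct (is_value A) eqn:HA.
      2:{ apply (admin (WhereT L (WhereT (App (Var 0) (ren_o S B)) A))).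
          - simpl. rewrite HA. auto.
          - simpl. rewrite HA. auto.
          - apply rr_wherer, rr_step, R_app_l; auto.
          - apply (C_app_l A B s c (kframe s c L (Tv x))); auto. }
      destruct (is_value B) eqn:HB.
      2:{ apply (admin (WhereT L (WhereT (App (ren_o S A) (Var 0)) B))).
          - simpl. rewrite HA. auto.
          - simpl. rewrite HA. auto.
          - apply rr_wherer, rr_step, R_app_r; auto.
          - apply (C_app_r A B s c (kframe s c L (Tv x))); auto. }
      rewrite C_App, HA, HB in H. destruct A as [y | M | | |]; try discriminate.
      * simpl in H. destruct (Hs y) as [z E]. rewrite E in H.
        (* The application is blocked on a variable, so its continuation, the frame of [L], is
           itself normalizing and yields the normal form of [L]. Opening that frame costs one more
           unit of height, whence [S m'] for the argument. *)
        inversion H as [| | | | m ? ? ? H1 H2 | |]; subst.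
        inversion H2 as [| | m' t H3 | | | |]; subst.
        destruct (value (S m') B) as (V' & ? & ? & ?); auto.
        destruct (real m' L (tup s) (shift c) (S x)) as (L' & ? & ?); auto.
        { apply is_ren_scons, is_ren_shift, Hs. }
        { apply is_ren_shift, Hc. }
        exists (WhereT L' (App (Var y) V')); split.
        -- eapply rr_trans; [apply rr_wherel | apply rr_wherer, rr_appr]; eauto.
        -- simpl; auto.
      * simpl in H. inversion H; subst. rewrite C_inst2, <- C_subst1 in * by auto.
        eapply nrm_rr; [apply rr_wherer, rr_step, R_beta; auto |].
        eapply nrm_rr; [apply rr_wherer, rr_step, R_where_val; auto |].
        apply (real n0 _ s c x); auto.
    + apply (admin (WhereT (WhereT (ren_o (upren S) L) M) N)); simpl; auto.
      * apply rr_equiv, rst_step, E1_t.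
      * apply C_where_where.
    + apply (admin (Mu (cs_j 0 (ren_c S L) J))).
      * simpl. rewrite (proj2 rk_cs). auto.
      * simpl. auto.
      * apply rr_step, R_where_mu.
      * apply C_where_mu.
  - apply nrm_mu. simpl in H, Hr. rewrite Cj_flat in H.
    (* Entering the [Mu] keeps the target term and its height; [rk] pays for the descent. *)
    assert (Hc' : is_ren (Tv x .: c)) by (apply is_ren_scons; auto).
    destruct (Hc' (flat_label J)) as [z E]. rewrite E in H.
    eapply (IHr (rkj J)); [lia | exact Hs | exact Hc' |
      rewrite rk_flat; auto | apply le_n | exact H].
Qed.

Lemma good_typable_normalizable M : good_typable M -> normalizable M.
Proof.
  intros H. apply good_typable_wn, wn_wnh in H. destruct H as [n H].
  apply nrm_normalizable. eapply wnh_nrm; [| | apply le_n | apply le_n | exact H];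
    intros x; eauto.
Qed.

Theorem theorem3p34 : forall M : term,
  (cbv_terminates M <-> exists G D T, typ G D M T) /\
  (normalizable M <->
     exists G D T, typ G D M T /\ ctx_ok G /\ dctx_ok D /\ ty_bad T = false).
Proof.
  intros M. split; split.
  - intros H. apply cbv_terminates_typable in H. destruct H as (G & D & T & H).
    do 3 eexists. apply den_typable, H.
  - intros (G & D & T & H). apply typable_cbv_terminates.
    do 3 eexists. apply typable_den, H.
  - intros H. apply normalizable_good_typable in H.
    destruct H as (G & D & T & H & HG & HD & HT).
    do 3 eexists. split; [apply den_typable, H |]. repeat split; auto.
    + intros x s E. apply nth_error_tabulate in E. injection E as ->. apply HG.
    + intros x s E. apply nth_error_tabulate in E. injection E as ->. apply HD.
  - intros (G & D & T & H & HG & HD & HT). apply good_typable_normalizable.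
    exists (ctx_fun G), (dctx_fun D), T.
    split; [apply typable_den, H |]. repeat split; auto using ctx_fun_good, dctx_fun_good.
Qed.
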